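(* Let $\mathcal{A}$ be an arrangement of nine lines in $\mathbb{CP}^2$. Then $\mathcal{A}$ is in one of the following classes: (1) arrangements whose moduli space $\mathcal{M}_{\mathcal{A}}$ is irreducible; (2) arrangements containing a MacLane arrangement as a sub-arrangement; (3) Falk-Sturmfels arrangements, i.e. arrangements lattice isomorphic to $FS^{\pm}$; (4) arrangements $\mathcal{A}^{\pm\sqrt{-1}}$, i.e. arrangements lattice isomorphic to $\mathcal{A}^{\pm\sqrt{-1}}$.
   Context: A line arrangement $\mathcal{A}=\{L_1,\dots,L_n\}$ is a finite collection of $n$ distinct lines in $\mathbb{CP}^2$, with coordinates $[x,y,z]$. Its intersection lattice is $L(\mathcal{A})=\{\bigcap_{i\in S}L_i \mid S\subseteq\{1,\dots,n\}\}$, partially ordered by reverse inclusion. Two arrangements $\mathcal{A}_1=\{G_1,\dots,G_n\}$ and $\mathcal{A}_2=\{H_1,\dots,H_n\}$ are lattice isomorphic if there is a permutation $\phi$ of $\{1,\dots,n\}$ with $\dim\bigcap_{i\in S}G_i=\dim\bigcap_{j\in\phi(S)}H_j$ for every nonempty $S\subseteq\{1,\dots,n\}$ (the empty set having its own dimension, e.g. $-1$). We write $L(\mathcal{A}_1)=L(\mathcal{A}_2)$ for ordered arrangements when this holds with $\phi$ the identity. Viewing an ordered arrangement as an $n$-tuple of points of the dual plane $(\mathbb{CP}^2)^*$, the (ordered) moduli space is $$\mathcal{M}_{\mathcal{A}}=\{\mathcal{B}\in((\mathbb{CP}^2)^* )^n \mid L(\mathcal{B})=L(\mathcal{A})\}/\mathrm{PGL}_3(\mathbb{C}),$$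 and irreducibility is with respect to the (quotient) Zariski topology. A point has multiplicity $r$ if exactly $r$ lines of the arrangement pass through it; triple and quadruple points have multiplicity $3$ and $4$. MacLane arrangement: an arrangement of eight lines with eight triple points such that each line passes through exactly three triple points. Up to projective equivalence, representatives are given by $xy(x-z)(y-z)(x-y)\big(x-\tfrac{1\pm\sqrt{-3}}{2}z\big)\big(y-\tfrac{1\pm\sqrt{-3}}{2}z\big)\big(\tfrac{-1\pm\sqrt{-3}}{2}x-y+z\big)=0$ (same sign choice throughout). Falk-Sturmfels arrangements: with $\gamma_\pm=\tfrac{1\pm\sqrt5}{2}$, $FS^{\pm}$ consists of the nine lines $x=0$; $x=\gamma_\pm(y-z)$; $y=z$; $x+y=z$; $x=z$; $x=\gamma_\pm y$; $y=0$; $x+y=(\gamma_\pm+1)z$; $z=0$. ($FS^+$ and $FS^-$ have the same intersection lattice.) $\mathcal{A}^{\pm\sqrt{-1}}$: the two arrangements of nine lines given by $xy(x-z)(y-z)(x\mp\sqrt{-1}z)(y\mp\sqrt{-1}z)(x-y)\big((\pm\sqrt{-1}-1)x\pm\sqrt{-1}y+z\big)\big((1\mp\sqrt{-1})x+y-z\big)=0$ (upper signs, respectively lower signs, throughout). They have the same intersection lattice. *)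

(* Defs.v *)
From HB Require Import structures.
From mathcomp Require Import all_boot all_order all_fingroup all_algebra.
From mathcomp Require Import mpoly generic_quotient.
From mathcomp Require Import boolp classical_sets functions cardinality.
From mathcomp Require Import topology_structure quotient_topology subtype_topology.

Set Implicit Arguments.
Unset Strict Implicit.
Unset Printing Implicit Defensive.

Import GRing.Theory Num.Theory.
Local Open Scope ring_scope.
Local Open Scope classical_set_scope.

(** * Points and lines of the projective plane *)

(* P^2(K): the one-dimensional subspaces of K^3.  The dual plane is the same
   type, [a : b : c] standing for the line a x + b y + c z = 0. *)
Definition proj_plane (K : fieldType) :=
  {V : {vspace 'rV[K]_3} | \dim V == 1%N}.

Section ProjectivePlane.
Variable K : fieldType.

Definition vec3 (a b c : K) : 'rV[K]_3 := \row_(j < 3) [:: a; b; c]`_j.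

Lemma dim_vec3_100 : \dim <[vec3 1 0 0]>%VS == 1%N.
Proof.
rewrite dim_vline eqb1; apply/eqP => /(congr1 (fun v : 'rV_3 => v 0 0)).
by rewrite !mxE /= => /eqP; rewrite oner_eq0.
Qed.

Definition point100 : proj_plane K := exist _ <[vec3 1 0 0]>%VS dim_vec3_100.

(* [a : b : c], with the junk value [1 : 0 : 0] when a = b = c = 0 *)
Definition hpoint (a b c : K) : proj_plane K :=
  insubd point100 <[vec3 a b c]>%VS.

Lemma val_hpoint a b c : vec3 a b c != 0 ->
  val (hpoint a b c) = <[vec3 a b c]>%VS.
Proof. by move=> nz; rewrite val_insubd dim_vline nz. Qed.

(* A nonzero vector of homogeneous coordinates *)
Definition hcoords (a : proj_plane K) : 'rV[K]_3 := vpick (val a).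

Lemma hcoords_neq0 a : hcoords a != 0.
Proof.
rewrite /hcoords vpick0; case: a => V /= /eqP dV.
by apply: contra_eq_neq dV => ->; rewrite dimv0.
Qed.

Lemma hcoordsE a : val a = <[hcoords a]>%VS.
Proof.
apply/eqP; rewrite eq_sym eqEdim -memvE memv_pick dim_vline hcoords_neq0 /=.
by case: a => V /= /eqP ->.
Qed.

(* The line of P^2 dual to a, as the two-dimensional subspace of K^3 lying
   over it: its projective dimension is its vector space dimension minus 1,
   and so on for intersections of lines, 0 lying over the empty set. *)
Definition line (a : proj_plane K) : {vspace 'rV[K]_3} :=
  lker (linfun (mulmxr (hcoords a)^T)).

Lemma mem_line a p : (p \in line a) = (p *m (hcoords a)^T == 0).
Proof. by rewrite memv_ker lfunE. Qed.

Lemma mem_line_hpoint a b c x y z : vec3 a b c != 0 ->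
  (vec3 x y z \in line (hpoint a b c)) = (a * x + b * y + c * z == 0).
Proof.
move=> nz; rewrite mem_line.
have: hcoords (hpoint a b c) \in <[vec3 a b c]>%VS.
  by rewrite -val_hpoint // memv_pick.
case/vlineP=> k hk; have k0 : k != 0.
  by apply: contraNneq (hcoords_neq0 (hpoint a b c)) => k0; rewrite hk k0 scale0r.
rewrite hk linearZ /= -scalemxAr scaler_eq0 (negPf k0) /=.
have -> : vec3 x y z *m (vec3 a b c)^T = (a * x + b * y + c * z)%:M.
  apply/rowP=> i; rewrite ord1 !mxE !big_ord_recl big_ord0 !mxE /= addr0 mulr1n.
  by rewrite ![_ * x]mulrC ![_ * y]mulrC ![_ * z]mulrC addrA.
apply/eqP/eqP => [/(congr1 (fun v : 'M_1 => v 0 0))|->]; last by rewrite raddf0.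
by rewrite !mxE mulr1n.
Qed.

Definition on_line (p a : proj_plane K) : bool := (val p <= line a)%VS.

End ProjectivePlane.

(** * Ordered arrangements *)

(* n-tuples of points of the dual plane *)
Definition config (K : fieldType) (n : nat) := {ffun 'I_n -> proj_plane K}.

HB.instance Definition _ (K : fieldType) (n : nat) := Choice.on (config K n).

Section Arrangements.
Variable K : fieldType.
Implicit Types n k r : nat.

Definition config_of n (t : n.-tuple (proj_plane K)) : config K n :=
  [ffun i => tnth t i].

Definition is_arrangement n (A : config K n) : Prop := injective A.

Definition subconfig k n (f : 'I_k -> 'I_n) (A : config K n) : config K k :=
  [ffun i => A (f i)].

Definition same_lattice n (A B : config K n) : Prop :=
  forall S : {set 'I_n}, S != finset.set0 ->
    \dim (\bigcap_(i in S) line (A i))%VS =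
    \dim (\bigcap_(i in S) line (B i))%VS.

Definition lattice_isomorphic n (A B : config K n) : Prop :=
  exists phi : 'S_n, forall S : {set 'I_n}, S != finset.set0 ->
    \dim (\bigcap_(i in S) line (A i))%VS =
    \dim (\bigcap_(j in (phi @: S)%SET) line (B j))%VS.

Definition multiplicity n (A : config K n) (p : proj_plane K) : nat :=
  #|[pred i | on_line p (A i)]|.

Definition triple_points n (A : config K n) : set (proj_plane K) :=
  [set p | multiplicity A p = 3%N].

Definition is_maclane (A : config K 8) : Prop :=
  [/\ is_arrangement A, (triple_points A #= `I_8)%card &
      forall i, (triple_points A `&` [set p | on_line p (A i)] #= `I_3)%card].

Definition contains_maclane n (A : config K n) : Prop :=
  exists2 f : 'I_8 -> 'I_n, injective f & is_maclane (subconfig f A).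

End Arrangements.

(** * The Zariski topology on (P^2)^n *)

Section Zariski.
Variables (K : fieldType) (n : nat).
Implicit Types (f g : {mpoly K[(n * 3)%N]}) (B : config K n).

(* The variable of index [mxvec_index i j] is the j-th homogeneous coordinate
   of the i-th factor. *)
Definition multihomogeneous f : Prop :=
  exists d : 'I_n -> nat, forall m, m \in msupp f ->
    forall i, (\sum_(j < 3) m (mxvec_index i j))%N = d i.

Definition coord_matrix B : 'M[K]_(n, 3) := \matrix_i hcoords (B i).

Definition meval_mx (M : 'M[K]_(n, 3)) f : K := f.@[fun k => mxvec M 0 k].

Definition vanishes_at f B : Prop := meval_mx (coord_matrix B) f = 0.

(* For multihomogeneous f, vanishing does not depend on the choice of
   homogeneous coordinates. *)
Lemma vanishes_atP f B (M : 'M[K]_(n, 3)) : multihomogeneous f ->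
  (forall i, val (B i) = <[row i M]>%VS) ->
  vanishes_at f B <-> meval_mx M f = 0.
Proof.
move=> [d hd] hM.
have /fin_all_exists [c hc] i : exists c, (c != 0) /\
    row i M = c *: hcoords (B i).
  have : row i M \in <[hcoords (B i)]>%VS by rewrite -hcoordsE hM memv_line.
  case/vlineP=> c hc; exists c; split => //.
  apply: contraTneq (hcoords_neq0 (B i)) => c0.
  have := hcoordsE (B i); rewrite hM hc c0 scale0r => h.
  by rewrite negbK -memv0; have := memv_line (hcoords (B i)); rewrite -h.
suff -> : meval_mx M f =
    (\prod_i c i ^+ d i) * meval_mx (coord_matrix B) f.
  have nz : \prod_i c i ^+ d i != 0.
    by rewrite prodf_seq_neq0; apply/allP => i _; rewrite expf_neq0 // (hc i).1.
  split=> [|/eqP]; first by rewrite /vanishes_at => ->; rewrite mulr0.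
  by rewrite mulf_eq0 (negPf nz) => /eqP.
rewrite /meval_mx !mevalE mulr_sumr; apply: eq_big_seq => m fm.
rewrite mulrCA; congr (_ * _).
have prodE (F : 'I_(n * 3) -> K) :
    \prod_k F k = \prod_i \prod_j F (mxvec_index i j).
  rewrite pair_bigA (reindex _ (curry_mxvec_bij n 3)) /=.
  by apply: eq_bigr => -[].
rewrite !prodE -big_split /=; apply: eq_bigr => i _.
rewrite -(hd _ fm i) -prodrXr -big_split /=; apply: eq_bigr => j _.
rewrite !mxvecE -exprMn; congr (_ ^+ _).
by have /(congr1 (fun v : 'rV_3 => v 0 j)) := (hc i).2; rewrite !mxE.
Qed.

Definition zero_locus (F : set {mpoly K[(n * 3)%N]}) : set (config K n) :=
  [set B | forall f, F f -> vanishes_at f B].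

Definition zariski_open (U : set (config K n)) : Prop :=
  exists2 F, F `<=` multihomogeneous & U = ~` zero_locus F.

Lemma multihomogeneousM f g :
  multihomogeneous f -> multihomogeneous g -> multihomogeneous (f * g).
Proof.
move=> [df hf] [dg hg]; exists (fun i => df i + dg i)%N => m.
move=> /msuppM_le /allpairsP [[m1 m2] /= [m1f m2g ->]] i.
rewrite -(hf _ m1f) -(hg _ m2g) -big_split /=.
by apply: eq_bigr => j _; rewrite mnmDE.
Qed.

Lemma zariski_openT : zariski_open setT.
Proof.
exists [set 1] => [f ->|].
  exists (fun=> 0%N) => m; rewrite msupp1 inE => /eqP -> i.
  by rewrite big1 // => j _; rewrite mnm0E.
rewrite -[LHS]setC0; congr (~` _); apply/seteqP; split => // B /(_ 1 erefl).
by rewrite /vanishes_at /meval_mx meval1 => /eqP; rewrite oner_eq0.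
Qed.

Lemma zariski_openI : setI_closed zariski_open.
Proof.
move=> _ _ [F hF ->] [G hG ->].
exists [set h | exists f g, [/\ F f, G g & h = f * g]].
  by move=> _ [f [g [/hF ? /hG ? ->]]]; exact: multihomogeneousM.
rewrite -setCU; congr (~` _); apply/seteqP; split => B.
  move=> [] h _ [f [g [Ff Gg ->]]]; rewrite /vanishes_at /meval_mx mevalM.
    by rewrite [X in X * _](h _ Ff) mul0r.
  by rewrite [X in _ * X](h _ Gg) mulr0.
move=> h; have [|nF] := pselect (zero_locus F B); first by left.
right=> g Gg; move/existsNP: nF => [f /not_implyP [Ff nf]].
have /eqP := h _ (ex_intro _ f (ex_intro _ g (And3 Ff Gg erefl))).
by rewrite /vanishes_at /meval_mx mevalM mulf_eq0 => /orP[|] /eqP.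
Qed.

Lemma zariski_open_bigU (I : Type) (U : I -> set (config K n)) :
  (forall i, zariski_open (U i)) -> zariski_open (\bigcup_i U i).
Proof.
move=> hU; pose F := [set f | multihomogeneous f /\
  forall B, ~ (\bigcup_i U i) B -> vanishes_at f B].
exists F; first by move=> f [].
apply/seteqP; split => B => [[i _ UB] ZB|nZ].
  have [G hG UE] := hU i; move: (UB); rewrite UE; apply=> g Gg; apply: ZB.
  split=> [|B' nU]; first exact: hG.
  have : ~ U i B' by move=> UB'; apply: nU; exists i.
  by rewrite UE => /contrapT; exact.
by apply: contrapT => nU; apply: nZ => f [_ /(_ _ nU)].
Qed.

End Zariski.

HB.instance Definition _ (K : fieldType) (n : nat) :=
  isOpenTopological.Build (config K n)
    (@zariski_openT K n) (@zariski_openI K n) (@zariski_open_bigU K n).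

Lemma zariski_closedP (K : fieldType) (n : nat) (Z : set (config K n)) :
  closed Z <-> exists2 F, F `<=` @multihomogeneous K n & Z = zero_locus F.
Proof.
rewrite -openC; split=> [[F hF]|[F hF ->]]; last by exists F.
by move/(congr1 (@setC _)); rewrite !setCK => ->; exists F.
Qed.

(** * Moduli spaces *)

Section Moduli.
Variables (K : fieldType) (n : nat).

(* The projective transformations are those induced by invertible matrices;
   scalar matrices act trivially, so PGL_3- and GL_3-orbits coincide. *)
Definition proj_equiv (A B : config K n) : Prop :=
  exists2 g : 'M[K]_3, g \in unitmx &
    forall i, line (B i) = (linfun (mulmxr g) @: line (A i))%VS.

Lemma proj_equiv_refl A : proj_equiv A A.
Proof.
exists 1%:M => [|i]; first exact: unitmx1.
rewrite -[LHS]lim1g; congr (_ @: _)%VS.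
by apply/lfunP => v; rewrite id_lfunE lfunE /= mulmx1.
Qed.

Lemma proj_equiv_sym A B : proj_equiv A B -> proj_equiv B A.
Proof.
move=> [g ug gAB]; exists (invmx g) => [|i]; first by rewrite unitmx_inv.
rewrite gAB -limg_comp -[LHS]lim1g; congr (_ @: _)%VS.
by apply/lfunP => v; rewrite id_lfunE comp_lfunE !lfunE /= mulmxK.
Qed.

Lemma proj_equiv_trans A B C :
  proj_equiv A B -> proj_equiv B C -> proj_equiv A C.
Proof.
move=> [g ug gAB] [h uh hBC]; exists (g *m h) => [|i].
  by rewrite unitmx_mul ug.
rewrite hBC gAB -limg_comp; congr (_ @: _)%VS.
by apply/lfunP => v; rewrite comp_lfunE !lfunE /= mulmxA.
Qed.

(* The set_type of this set carries the subspace topology. *)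
Definition realizations (A : config K n) : set (config K n) :=
  [set B | same_lattice B A].

Variable A : config K n.

Definition realizations_equiv (B C : realizations A) : bool :=
  `[< proj_equiv (val B) (val C) >].

Lemma realizations_equiv_is_equiv :
  equiv_class_of realizations_equiv.
Proof.
split=> [B|B C|C B D].
- exact/asboolP/proj_equiv_refl.
- by apply/asboolP/asboolP; exact: proj_equiv_sym.
- by move=> /asboolP BC /asboolP CD; apply/asboolP/(proj_equiv_trans BC).
Qed.

Canonical realizations_equivRel := EquivRelPack realizations_equiv_is_equiv.

Definition moduli_space : topologicalType :=
  quotient_topology {eq_quot realizations_equivRel}%qT.

End Moduli.

Definition irreducible_space (T : topologicalType) : Prop :=
  [set: T] !=set0 /\
  forall F G : set T, closed F -> closed G -> F `|` G = setT ->
    F = setT \/ G = setT.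

(** * The Falk-Sturmfels arrangements and the arrangements A^(+-sqrt(-1)) *)

(* The sign is + when s = false, - when s = true. *)
Section Examples.
Variables (K : numClosedFieldType) (s : bool).

Definition falk_sturmfels : config K 9 :=
  let gamma : K := (1 + (-1) ^+ s * sqrtC 5) / 2 in
  config_of [tuple
    hpoint 1 0 0;
    hpoint 1 (- gamma) gamma;
    hpoint 0 1 (- 1);
    hpoint 1 1 (- 1);
    hpoint 1 0 (- 1);
    hpoint 1 (- gamma) 0;
    hpoint 0 1 0;
    hpoint 1 1 (- (gamma + 1));
    hpoint 0 0 1].

Definition arrangement_sqrtN1 : config K 9 :=
  let I : K := (-1) ^+ s * 'i in
  config_of [tuple
    hpoint 1 0 0;
    hpoint 0 1 0;
    hpoint 1 0 (- 1);
    hpoint 0 1 (- 1);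
    hpoint 1 0 (- I);
    hpoint 0 1 (- I);
    hpoint 1 (- 1) 0;
    hpoint (I - 1) I 1;
    hpoint (1 - I) 1 (- 1)].

End Examples.

(* Main.v *)
(* Dually, an arrangement is a configuration of nine points, and its lattice is the set of its
   collinear triples. If a point [e] lies on at most two lines with two or more further points, a
   realization is obtained from one of the configuration without [e] by choosing [e] in the plane,
   on a line, or at the intersection of two lines. So a polynomial curve joining two realizations
   of the smaller configuration extends to one joining the realizations of the whole, and when all
   pairs of realizations are joined by such curves the moduli space is irreducible. This leaves
   the configurations in which every point lies on at least three lines. Up to isomorphism a
   finite search yields twelve of them with at most nine points: two are not realizable in
   characteristic zero, four contain or are MacLane's, four are parametrized rationally after
   solving their incidences in a projective frame, and the last two are the lattices of
   Falk-Sturmfels and of the arrangements defined over the Gaussian numbers. *)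
Require Import Defs.
From mathcomp Require Import all_boot all_algebra.
From mathcomp Require Import complex reals.
From mathcomp Require Import all_fingroup mpoly generic_quotient.
From mathcomp Require Import boolp classical_sets functions cardinality.
From mathcomp Require Import topology_structure quotient_topology subtype_topology.
From mathcomp Require Import zify ring.

Set Implicit Arguments.
Unset Strict Implicit.
Unset Printing Implicit Defensive.
Import GRing.Theory Num.Theory.

(** * Enumeration of the incidence patterns *)

(** Only the two ends and the generic points of a joining curve matter: it may pass through
    degenerate configurations. So everything is interpolated entrywise and linearly, including the
    matrices that carry the two ends to a common projective frame, although they may become singular
    in between.

    A curve for a subset of the points joins restrictions of realizations of the whole arrangement.
    A removed point thus still has prescribed positions at both ends, and putting it back means
    meeting these two positions while keeping its collinearities.

    The set that remains when no point can be removed has at least seven points. On seven or eight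
    points it is a Fano plane or MacLane's pattern, both of which settle the matter at once. Hence a
    pattern that has to be parametrized always consists of all nine points, and nothing is left to
    add to the parametrization.

    The search needs no completeness statement about patterns beyond soundness: the branch
    prescribed by the actual collinearities is never closed before it reaches an accepted leaf. *)

Fixpoint every (T : Type) (p : T -> bool) (s : seq T) : bool :=
  if s is x :: s' then if p x then every p s' else false else true.
(** [every], [some] and [coll] branch with [if] because [vm_compute] is strict: it would evaluate
    both arguments of a boolean connective. *)
Fixpoint some (T : Type) (p : T -> bool) (s : seq T) : bool :=
  if s is x :: s' then if p x then true else some p s' else false.
Definition occurs (x : nat) (l : seq nat) : bool := some (eqn x) l.
Definition coll (ls : seq (seq nat)) (x y z : nat) : bool :=
  some (fun l => if occurs x l then if occurs y l then occurs z l else false else false) ls.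

Lemma everyE T (p : T -> bool) s : every p s = all p s.
Proof. by elim: s => //= x s ->; case: (p x). Qed.

Lemma someE T (p : T -> bool) s : some p s = has p s.
Proof. by elim: s => //= x s ->; case: (p x). Qed.

Lemma occursE x l : occurs x l = (x \in l).
Proof. by rewrite /occurs someE -has_pred1; apply: eq_has => y; rewrite /= eq_sym. Qed.

Lemma collE ls x y z : coll ls x y z = has (fun l => [&& x \in l, y \in l & z \in l]) ls.
Proof.
by rewrite /coll someE; apply: eq_has => l; rewrite !occursE; case: (x \in l) (y \in l) => -[].
Qed.

Definition list_at (s : seq (seq nat)) (i : nat) : seq nat := nth [::] s i.

Fixpoint cliques (unc : seq (seq nat)) (s : seq nat) : seq (seq nat) :=
  if s is x :: s' then
    let r := cliques unc s' in
    r ++ [seq x :: t | t <- r & every (fun y => occurs y (list_at unc x)) t]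
  else [:: [::]].

(** The predicate [p] will be collinearity with a chosen pair: the other points of the actual line
    are then one of the listed candidates. *)
Lemma mem_cliques unc s (p : pred nat) : uniq s ->
  {in s &, forall x y, p x -> p y -> x != y -> y \in list_at unc x} ->
  [seq x <- s | p x] \in cliques unc s.
Proof.
elim: s => // x s IH /= /andP[xs us] h.
have {}IH : [seq x <- s | p x] \in cliques unc s.
  by apply: IH => // y z ys zs; apply: h; rewrite inE ?ys ?zs orbT.
rewrite mem_cat; case: ifP => px; last by rewrite IH.
apply/orP; right; apply/map_f; rewrite mem_filter IH andbT everyE.
apply/allP => y; rewrite mem_filter occursE => /andP[py ys].
by apply: h; rewrite ?inE ?eqxx ?ys ?orbT //; apply: contraNneq xs => ->.
Qed.

(** A branching heuristic: a shortest non-empty row leaves few cliques to try. Soundness uses only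
    that the chosen pair is unknown and that [None] means that no unknown pair is left. *)
Fixpoint next_pair (i : nat) (unc : seq (seq nat)) (best : option (nat * nat * nat)) :=
  match unc with
  | [::] => best
  | [::] :: u => next_pair i.+1 u best
  | (j :: r) :: u =>
      let n := size r in
      next_pair i.+1 u (if best is Some (m, _, _)
                     then if m <= n then best else Some (n, i, j)
                     else Some (n, i, j))
  end.

Lemma next_pair_some unc n i j :
  next_pair 0 unc None = Some (n, i, j) -> j \in list_at unc i.
Proof.
suff H u b w : unc = w ++ u -> (forall n i j, b = Some (n, i, j) -> j \in list_at unc i) ->
    forall n i j, next_pair (size w) u b = Some (n, i, j) -> j \in list_at unc i.
  by apply: (H unc None [::]).
elim: u b w => [b w _ hb|[|x r] u IH b w uE hb] //= {}n {}i {}j.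
  by rewrite -(size_rcons w [::]); apply: IH; rewrite // cat_rcons.
rewrite -(size_rcons w (x :: r)); apply: IH; first by rewrite cat_rcons.
have hx : x \in list_at unc (size w) by rewrite uE /list_at nth_cat ltnn subnn mem_head.
move=> n' i' j'; case: b hb => [[[m i1] j1]|] hb; last by case=> _ <- <-.
by case: ifP => _; [exact: hb | case=> _ <- <-].
Qed.

Lemma next_pair_none unc i : next_pair 0 unc None = None -> list_at unc i = [::].
Proof.
have nN u (b : option (nat * nat * nat)) k : b -> next_pair k u b <> None.
  elim: u b k => [|[|x r] u IH] [[[m i1] j1]|] k //= _; first exact: IH.
  by apply: IH; case: ifP.
rewrite /list_at; elim: unc 0 i => [|[|x r] u IH] k [|i] //=; first exact: IH.
by move=> h; case: (nN u (Some (size r, k, x)) k.+1).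
by move=> h; case: (nN u (Some (size r, k, x)) k.+1).
Qed.

(* The points are numbered from the three lines 012, 034, 056 through a first point. *)
Definition known_lines := [:: [:: 0; 1; 2]; [:: 0; 3; 4]; [:: 0; 5; 6]].
Definition known_free := [:: [:: 0; 1; 3]; [:: 0; 1; 5]; [:: 0; 3; 5]].

(** The three starting lines may contain further points, so they do not enter the state as lines.
    They only filter candidates: a line meets a collinear triple in 0, 1 or 3 points and contains no
    non-collinear one. *)
Definition consistent (l : seq nat) : bool :=
  if every (fun t => ~~ eqn (count (occurs^~ l) t) 2) known_lines
  then every (fun t => ~~ eqn (count (occurs^~ l) t) 3) known_free else false.

(** * Points on three lines, and the search with its soundness *)

Section Rich.
Variables (T : eqType) (D : pred T) (c : T -> T -> T -> bool).

(* Three lines [x a_t b_t] through [x], each with two further points of [D]. *)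
Definition rich (x : T) := exists a1 b1 a2 b2 a3 b3,
  [/\ all (fun y => D y && (y != x)) [:: a1; b1; a2; b2; a3; b3],
      [&& a1 != b1, a2 != b2 & a3 != b3],
      [&& c x a1 b1, c x a2 b2 & c x a3 b3] &
      [&& ~~ c x a1 a2, ~~ c x a1 a3 & ~~ c x a2 a3]].

Hypothesis cC : forall x y z, c x y z = c y x z.
Hypothesis cCA : forall x y z, c x y z = c x z y.
Hypothesis cxx : forall x y, c x x y.
Hypothesis c_trans : forall x y z t, D x -> D y -> x != y ->
  c x y z -> c x y t -> c x z t.

(** Distinct lines through [x] meet only in [x]: a further common point would make [a] and [a']
    collinear with [x]. *)
Lemma disjoint_pairs x a b a' b' : D x -> D b -> b != x ->
  c x a b -> c x a' b' -> ~~ c x a a' ->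
  [&& a != a', a != b', b != a' & b != b'].
Proof.
move=> xD bD bx cab cab' naa'; apply/and4P; split; apply: contraNneq naa'.
- by move=> <-; rewrite cC cCA.
- by move=> ->; rewrite cCA.
- by move=> <-.
- move=> bb'; have xb : x != b by rewrite eq_sym.
  by apply: (c_trans xD bD xb); rewrite cCA // bb'.
Qed.
End Rich.

(* In a state of the search, [ls] lists the lines with at least three points found so far, and
   [list_at unc i] the points [j] such that the line through [i] and [j] is still unknown. The
   points of an unknown line are pairwise unknown, so they form a clique of [unc]. *)
Section Search.
Variables (k : nat) (leaf : seq (seq nat) -> bool).

(* Each line through [i] that is still to be found takes two points from [list_at unc i]. *)
Definition alive (ls unc : seq (seq nat)) : bool :=
  every (fun i => 2 < count (occurs i) ls + (size (list_at unc i))./2) (iota 0 k).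

Definition remove_line (l : seq nat) (unc : seq (seq nat)) : seq (seq nat) :=
  mkseq (fun i => let u := list_at unc i in
                  if occurs i l then [seq x <- u | ~~ occurs x l] else u) k.

(** The value [true] says that each branch is refuted or ends in an accepted leaf. A live branch
    without fuel yields [false], so the amount of fuel needs no proof. Lines with only two points
    are settled but not recorded. *)
Fixpoint search (fuel : nat) (ls unc : seq (seq nat)) : bool :=
  if ~~ alive ls unc then true else
  if fuel is f.+1 then
    if next_pair 0 unc None is Some (_, i, j) then
      every (fun s =>
               let l := [seq x <- iota 0 k | [|| eqn x i, eqn x j | occurs x s]] in
               if consistent l
               then search f (if 2 < size l then l :: ls else ls) (remove_line l unc)
               else true)
        (cliques unc [seq x <- list_at unc i | occurs x (list_at unc j)])
    else leaf ls
  else false.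

Definition uncovered0 : seq (seq nat) := mkseq (fun i => [seq x <- iota 0 k | x != i]) k.

Variable c : nat -> nat -> nat -> bool.

Hypothesis cC : forall x y z, c x y z = c y x z.
Hypothesis cCA : forall x y z, c x y z = c x z y.
Hypothesis cxx : forall x y, c x x y.
Hypothesis c_trans : forall x y z t, x < k -> y < k -> x != y ->
  c x y z -> c x y t -> c x z t.

Definition ln i j := [seq x <- iota 0 k | c i j x].

Let mem_ln i j x : (x \in ln i j) = (x < k) && c i j x.
Proof. by rewrite mem_filter mem_iota add0n andbC. Qed.

Let cyxy x y : c x y y. Proof. by rewrite cC cCA. Qed.
Let cxyx x y : c x y x. Proof. by rewrite cCA. Qed.

Let ln_eq i j x y : i < k -> j < k -> i != j -> x \in ln i j -> y \in ln i j ->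
  x != y -> ln x y = ln i j.
Proof.
move=> ik jk ij; rewrite !mem_ln => /andP[xk cx] /andP[yk cy] xy.
have cxy z : c i j z -> c x y z.
  move=> cz.
  have cixy := c_trans ik jk ij cx cy; have cixz := c_trans ik jk ij cx cz.
  have [ix|ix] := eqVneq i x; last first.
    rewrite cC in cixy; rewrite cC in cixz.
    by apply: (c_trans (y := i)); rewrite // eq_sym.
  have jxy : c j x y by apply: (c_trans (y := i)); rewrite // 1?eq_sym // cC.
  by rewrite -ix; apply: c_trans ik jk ij cy cz.
have cij z : c x y z -> c i j z.
  move=> cz.
  have cxyi : c x y i by exact: cxy.
  have cxyj : c x y j by exact: cxy.
  have h1 := c_trans xk yk xy cxyi cz; have h2 := c_trans xk yk xy cxyi cxyj.
  have [xi|xi] := eqVneq x i; first by rewrite -xi; exact: c_trans xk yk xy cxyj cz.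
  rewrite cC in h1; rewrite cC in h2.
  by apply: (c_trans (y := x)); rewrite // eq_sym.
by apply: eq_in_filter => z _; apply/idP/idP; [exact: cij|exact: cxy].
Qed.

(** The key clause is [inv_uncovered]: being unknown is a property of a whole line, not of a pair.
    It makes the points of an unknown line a clique. *)
Record search_inv (ls unc : seq (seq nat)) : Prop := Inv {
  inv_lines : forall l, l \in ls -> exists i j,
    [/\ i < k, j < k, i != j & l = ln i j];
  inv_remove_lineed : forall i j, i < k -> j < k -> i != j -> j \notin list_at unc i ->
    2 < size (ln i j) -> ln i j \in ls;
  inv_uncovered : forall i j, i < k -> j \in list_at unc i -> forall x y, x \in ln i j ->
    y \in ln i j -> x != y -> y \in list_at unc x;
  inv_row : forall i j, i < k -> j \in list_at unc i -> (j < k) && (j != i);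
  inv_uniq : forall i, uniq (list_at unc i);
  inv_out : forall i, k <= i -> list_at unc i = [::] }.

Let row_mkseq (f : nat -> seq nat) i : list_at (mkseq f k) i = if i < k then f i else [::].
Proof.
case: ltnP => ik; first by rewrite /list_at nth_mkseq.
by rewrite /list_at nth_default // size_mkseq.
Qed.

Lemma inv0 : search_inv [::] uncovered0.
Proof.
split=> //.
- move=> i j ik jk ij; rewrite row_mkseq ik mem_filter mem_iota /= add0n jk.
  by rewrite eq_sym ij.
- move=> i j ik; rewrite row_mkseq ik mem_filter => /andP[ji jk] x y.
  rewrite !mem_ln => /andP[xk _] /andP[yk _] xy.
  by rewrite row_mkseq xk mem_filter eq_sym xy mem_iota.
- by move=> i j ik; rewrite row_mkseq ik mem_filter mem_iota add0n andbC.
- by move=> i; rewrite row_mkseq; case: ifP => // _; rewrite filter_uniq ?iota_uniq.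
- by move=> i; rewrite row_mkseq ltnNge => ->.
Qed.

Lemma inv_remove_line ls unc i j : search_inv ls unc -> i < k -> j \in list_at unc i ->
  search_inv (if 2 < size (ln i j) then ln i j :: ls else ls) (remove_line (ln i j) unc).
Proof.
move=> I ik ji; have /andP[jk ij] := inv_row I ik ji; rewrite eq_sym in ij.
have rowE x : list_at (remove_line (ln i j) unc) x =
    if x \in ln i j then [seq y <- list_at unc x | y \notin ln i j] else list_at unc x.
  rewrite row_mkseq occursE; case: ltnP => xk; last by rewrite (inv_out I xk) if_same.
  by case: ifP => // _; apply: eq_filter => y; rewrite occursE.
have row_sub x y : y \in list_at (remove_line (ln i j) unc) x -> y \in list_at unc x.
  by rewrite rowE; case: ifP => // _; rewrite mem_filter => /andP[].
split.
- move=> l; case: ifP => [_|_ /(inv_lines I)] //.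
  by rewrite inE => /predU1P[->|/(inv_lines I)] //; exists i, j.
- move=> x y xk yk xy; rewrite rowE.
  have old : y \notin list_at unc x -> 2 < size (ln x y) ->
      ln x y \in (if 2 < size (ln i j) then ln i j :: ls else ls).
    move=> /(inv_remove_lineed I xk yk xy) h /h h'; case: ifP => // _.
    by rewrite inE h' orbT.
  case: ifP => // xl; rewrite mem_filter negb_and negbK => /orP[yl|]; last exact: old.
  by rewrite (ln_eq ik jk ij xl yl xy) => ->; rewrite mem_head.
- move=> x y xk yx' p q px qx pq.
  have yx := row_sub _ _ yx'; have /andP[yk yxn] := inv_row I xk yx.
  have qp := inv_uncovered I xk yx px qx pq.
  rewrite rowE; case: ifP => // pl; rewrite mem_filter qp andbT.
  (* If [q] too were on the line just settled, that line would be [ln x y], and [y] would have been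
     removed from the row of [x]. *)
  apply/negP => ql; move: yx'; rewrite rowE.
  have E : ln x y = ln i j.
    rewrite -(ln_eq ik jk ij pl ql pq); apply/esym/(ln_eq xk yk _ px qx pq).
    by rewrite eq_sym.
  have -> : x \in ln i j by rewrite -E mem_ln xk cxyx.
  by rewrite mem_filter -E mem_ln yk cyxy.
- by move=> x y xk /row_sub /(inv_row I xk).
- move=> x; rewrite rowE; case: ifP => _; rewrite ?filter_uniq //; exact: inv_uniq I x.
- by move=> x xk; rewrite rowE (inv_out I xk) /= if_same.
Qed.

Let rich_split ls unc x a b : search_inv ls unc -> x < k -> a < k -> b < k ->
  a != x -> b != x -> a != b -> c x a b ->
  (ln x a \in ls) || ((a \in list_at unc x) && (b \in list_at unc x)).
Proof.
move=> I xk ak bk ax bx ab cxab.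
have [xin|xnin] := boolP (a \in list_at unc x).
  apply/orP; right => /=; apply: (inv_uncovered I xk xin).
  - by rewrite mem_ln xk cxyx.
  - by rewrite mem_ln bk.
  - by rewrite eq_sym.
apply/orP; left; apply: (inv_remove_lineed I) => //; first by rewrite eq_sym.
have <- : size [:: x; a; b] = 3 by [].
apply: uniq_leq_size; first by rewrite /= !inE negb_or ab eq_sym ax eq_sym bx.
by move=> z; rewrite !inE mem_ln => /or3P[] /eqP ->; rewrite ?xk ?ak ?bk ?cxyx ?cyxy.
Qed.

(** Each of the three lines of a rich point is either recorded or contributes two points to the row
    of [x]; [disjoint_pairs] prevents double counting. *)
Lemma inv_alive ls unc : search_inv ls unc -> (forall x, x < k -> rich (gtn k) c x) -> alive ls unc.
Proof.
move=> I hrich; rewrite /alive everyE; apply/allP => x; rewrite mem_iota add0n /= => xk.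
have [a1 [b1 [a2 [b2 [a3 [b3 []]]]]]] := hrich x xk.
move=> /= /and5P[/andP[a1k a1x] /andP[b1k b1x] /andP[a2k a2x] /andP[b2k b2x]].
move=> /andP[/andP[a3k a3x] /andP[/andP[b3k b3x] _]] /and3P[ab1 ab2 ab3].
move=> /and3P[c1 c2 c3] /and3P[n12 n13 n23].
have cnt : count (occurs x) ls = size [seq l <- ls | x \in l].
  by rewrite size_filter; apply: eq_count => l; rewrite occursE.
have nl a b : b < k -> ~~ c x a b -> ln x a != ln x b.
  by move=> bk; apply: contraNneq => E; have := mem_ln x a b; rewrite E mem_ln bk cyxy.
have dis := @disjoint_pairs _ (gtn k) _ cC cCA cxx c_trans x.
have xl a : x \in ln x a by rewrite mem_ln xk cxyx.
have X ss : uniq ss -> all (fun l => (l \in ls) && (x \in l)) ss -> size ss <= count (occurs x) ls.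
  move=> us /allP h; rewrite cnt; apply: uniq_leq_size => // l /h.
  by rewrite mem_filter andbC.
have U ss : uniq ss -> all (fun y => y \in list_at unc x) ss -> size ss <= size (list_at unc x).
  by move=> us /allP h; apply: uniq_leq_size.
have /and4P[d1 d2 d3 d4] := dis _ _ _ _ xk b1k b1x c1 c2 n12.
have /and4P[d5 d6 d7 d8] := dis _ _ _ _ xk b1k b1x c1 c3 n13.
have /and4P[d9 d10 d11 d12] := dis _ _ _ _ xk b2k b2x c2 c3 n23.
have l12 := nl _ _ a2k n12; have l13 := nl _ _ a3k n13; have l23 := nl _ _ a3k n23.
have s1 := rich_split I xk a1k b1k a1x b1x ab1 c1.
have s2 := rich_split I xk a2k b2k a2x b2x ab2 c2.
have s3 := rich_split I xk a3k b3k a3x b3x ab3 c3.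
have half m : m.*2 <= size (list_at unc x) -> m <= (size (list_at unc x))./2.
  by move=> h; rewrite -(doubleK m) half_leq.
have conclude ss ts : 3 <= size ss + (size ts)./2 -> uniq ss ->
    all (fun l => (l \in ls) && (x \in l)) ss -> uniq ts ->
    all (fun y => y \in list_at unc x) ts -> 2 < count (occurs x) ls + (size (list_at unc x))./2.
  move=> h us hs ut ht; apply: leq_trans h _; apply: leq_add; first exact: X.
  by apply: half_leq; exact: U.
(* Eight cases: [ss] collects those of the three lines that are recorded, [ts] the pairs of points
   on the others. *)
case/orP: s1 => [s1|/andP[s1 t1]]; case/orP: s2 => [s2|/andP[s2 t2]];
  case/orP: s3 => [s3|/andP[s3 t3]].
- by apply: (conclude [:: ln x a1; ln x a2; ln x a3] [::]);
    rewrite //= ?inE ?negb_or ?l12 ?l13 ?l23 ?s1 ?s2 ?s3 ?xl.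
- by apply: (conclude [:: ln x a1; ln x a2] [:: a3; b3]);
    rewrite //= ?inE ?negb_or ?l12 ?ab3 ?s1 ?s2 ?s3 ?t3 ?xl.
- by apply: (conclude [:: ln x a1; ln x a3] [:: a2; b2]);
    rewrite //= ?inE ?negb_or ?l13 ?ab2 ?s1 ?s2 ?s3 ?t2 ?xl.
- by apply: (conclude [:: ln x a1] [:: a2; b2; a3; b3]);
    rewrite //= ?inE ?negb_or ?ab2 ?ab3 ?s1 ?s2 ?s3 ?t2 ?t3 ?xl ?d9 ?d10 ?d11 ?d12.
- by apply: (conclude [:: ln x a2; ln x a3] [:: a1; b1]);
    rewrite //= ?inE ?negb_or ?l23 ?ab1 ?s1 ?s2 ?s3 ?t1 ?xl.
- by apply: (conclude [:: ln x a2] [:: a1; b1; a3; b3]);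
    rewrite //= ?inE ?negb_or ?ab1 ?ab3 ?s1 ?s2 ?s3 ?t1 ?t3 ?xl ?d5 ?d6 ?d7 ?d8.
- by apply: (conclude [:: ln x a3] [:: a1; b1; a2; b2]);
    rewrite //= ?inE ?negb_or ?ab2 ?ab1 ?s1 ?s2 ?s3 ?t2 ?t1 ?xl ?d1 ?d2 ?d3 ?d4.
- by apply: (conclude [::] [:: a1; b1; a2; b2; a3; b3]);
    rewrite //= ?inE ?negb_or ?ab1 ?ab2 ?ab3 ?s1 ?s2 ?s3 ?t1 ?t2 ?t3 ?d1 ?d2 ?d3 ?d4
      ?d5 ?d6 ?d7 ?d8 ?d9 ?d10 ?d11 ?d12.
Qed.

Lemma consistent_ln i j : i < k -> j < k -> i != j -> 6 < k ->
  [&& c 0 1 2, c 0 3 4 & c 0 5 6] ->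
  [&& ~~ c 0 1 3, ~~ c 0 1 5 & ~~ c 0 3 5] -> consistent (ln i j).
Proof.
move=> ik jk ij k6 /and3P[p1 p2 p3] /and3P[n1 n2 n3].
have third x y z : x < k -> y < k -> z < k -> x != y -> c x y z ->
    (x \in ln i j) && (y \in ln i j) ==> (z \in ln i j).
  move=> xk yk zk xy cxyz; apply/implyP => /andP[xl yl].
  by rewrite -(ln_eq ik jk ij xl yl xy) mem_ln zk.
have lt m : m <= 6 -> m < k by move=> h; exact: leq_ltn_trans h k6.
have two x y z : x <= 6 -> y <= 6 -> z <= 6 -> x != y -> x != z -> y != z -> c x y z ->
    ~~ eqn (count (occurs^~ (ln i j)) [:: x; y; z]) 2.
  move=> x6 y6 z6 xy xz yz cxyz; rewrite /= !occursE.
  have := third _ _ _ (lt _ x6) (lt _ y6) (lt _ z6) xy cxyz.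
  have cxzy : c x z y by rewrite cCA.
  have cyzx : c y z x by rewrite cCA cC.
  have := third _ _ _ (lt _ x6) (lt _ z6) (lt _ y6) xz cxzy.
  have := third _ _ _ (lt _ y6) (lt _ z6) (lt _ x6) yz cyzx.
  by case: (x \in ln i j) (y \in ln i j) (z \in ln i j) => -[] [].
have three x y z : x <= 6 -> y <= 6 -> z <= 6 -> x != y -> ~~ c x y z ->
    ~~ eqn (count (occurs^~ (ln i j)) [:: x; y; z]) 3.
  move=> x6 y6 z6 xy cxyz; rewrite /= !occursE.
  have : ~~ [&& x \in ln i j, y \in ln i j & z \in ln i j].
    apply: contra cxyz => /and3P[xl yl]; rewrite -(ln_eq ik jk ij xl yl xy) mem_ln.
    by case/andP.
  by case: (x \in ln i j) (y \in ln i j) (z \in ln i j) => -[] [].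
by rewrite /consistent /= !two ?three.
Qed.

Definition spans_lines ls := forall x y z, x < k -> y < k -> z < k ->
  x != y -> x != z -> y != z -> c x y z = coll ls x y z.

Lemma inv_spans ls unc : search_inv ls unc -> (forall i, list_at unc i = [::]) -> spans_lines ls.
Proof.
move=> I unc0 x y z xk yk zk xy xz yz; rewrite collE; apply/idP/hasP => [cxyz|].
  exists (ln x y); last by rewrite !mem_ln xk yk zk cxyx cyxy cxyz.
  apply: (inv_remove_lineed I) => //; first by rewrite unc0.
  have <- : size [:: x; y; z] = 3 by [].
  apply: uniq_leq_size; first by rewrite /= !inE negb_or xy xz yz.
  by move=> t; rewrite !inE mem_ln => /or3P[] /eqP ->; rewrite ?xk ?yk ?zk ?cxyx ?cyxy.
move=> [l /(inv_lines I) [i [j [ik jk ij ->]]] /and3P[xl yl]].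
by rewrite -(ln_eq ik jk ij xl yl xy) mem_ln zk.
Qed.

(** All branches succeed by hypothesis; the proof descends along the one in which each candidate is
    the actual line [ln i j] of [c]. The invariant keeps this branch alive. *)
Theorem search_sound fuel ls unc : 6 < k ->
  [&& c 0 1 2, c 0 3 4 & c 0 5 6] ->
  [&& ~~ c 0 1 3, ~~ c 0 1 5 & ~~ c 0 3 5] ->
  (forall x, x < k -> rich (gtn k) c x) ->
  search_inv ls unc -> search fuel ls unc -> exists2 ls', leaf ls' & spans_lines ls'.
Proof.
move=> k6 pos neg hrich; elim: fuel ls unc => [|f IH] ls unc I /=.
  by rewrite (inv_alive I hrich).
rewrite (inv_alive I hrich) /=.
case E: next_pair => [[[n i] j]|]; last first.
  by move=> lf; exists ls => //; apply: (inv_spans I) => i; exact: next_pair_none E.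
have ji := next_pair_some E.
have ik : i < k by rewrite ltnNge; apply/negP => /(inv_out I) u; rewrite u in ji.
have /andP[jk] := inv_row I ik ji; rewrite eq_sym => ij.
rewrite everyE => /allP H.
pose cand := [seq x <- list_at unc i | occurs x (list_at unc j)].
have lnE : [seq x <- iota 0 k |
    [|| eqn x i, eqn x j | occurs x [seq x <- cand | c i j x]]] = ln i j.
  apply: eq_in_filter => x; rewrite mem_iota add0n /= => xk; rewrite occursE !mem_filter occursE.
  have [->|xi] := eqVneq x i; first by rewrite eqnE eqxx cxyx.
  have [->|xj] := eqVneq x j; first by rewrite !eqnE eqxx orbT cyxy.
  rewrite !eqnE (negPf xi) (negPf xj) /=.
  have [cx|] //= := boolP (c i j x).
  have xl : x \in ln i j by rewrite mem_ln xk.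
  rewrite !(inv_uncovered I ik ji _ xl) // 1?eq_sym // mem_ln ?ik ?jk ?cxyx ?cyxy //.
have /H : [seq x <- cand | c i j x] \in cliques unc cand.
  apply: mem_cliques; first by rewrite filter_uniq // (inv_uniq I).
  move=> x y; rewrite !mem_filter => /andP[_ xi] /andP[_ yi] cx cy.
  have /andP[xk _] := inv_row I ik xi; have /andP[yk _] := inv_row I ik yi.
  by apply: (inv_uncovered I ik ji); rewrite mem_ln ?xk ?yk.
rewrite lnE consistent_ln //; apply: IH; exact: inv_remove_line.
Qed.
End Search.

(** * Recognition of a line system up to isomorphism *)

(* An isomorphism invariant: twice the number of lines through [p], plus one if [p] is apart from
   two points that are apart from each other. It only prunes [embed], whose result is validated
   by [induced], so nothing is proved about it. *)
Definition color k (tab : seq (seq nat)) n (ls : seq (seq nat)) p :=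
  let apart x y := eqn n (nth 0 (list_at tab x) y) in
  let s := [seq x <- iota 0 k | if eqn x p then false else apart p x] in
  (count (occurs p) ls).*2
    + some (fun x => some (fun y => if eqn x y then false else apart x y) s) s.

(** A pair on no listed line gets [size ls], the value of [find] on failure; [color] and [embed]
    receive this number as [n]. *)
Definition line_table k (ls : seq (seq nat)) : seq (seq nat) :=
  mkseq (fun i => mkseq (fun j => find (fun l => if occurs i l then occurs j l else false) ls) k) k.

Definition embed_step := (nat * option (nat * nat) * seq (nat * nat * bool))%type.

(** A pair of earlier points collinear with [t], if there is one, confines the image of [t] to a
    known line. The positive tests come first, being the more selective ones. *)
Definition plan n (pl : seq (seq nat)) : seq embed_step :=
  let pairs t := [seq (ab, coll pl ab.1 ab.2 t)
                 | ab <- [seq (a, b) | b <- iota 0 t, a <- iota 0 b]] in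
  let tab := line_table n pl in
  mkseq (fun t => let pos := [seq x <- pairs t | x.2] in
    (color n tab (size pl) pl t, ohead (map fst pos),
     pos ++ [seq x <- pairs t | ~~ x.2])) n.

Definition induced np (pl ls : seq (seq nat)) (k : nat) (m : seq nat) : bool :=
  [&& size m == np, uniq m, all (gtn k) m &
    all (fun t => all (fun b => all (fun a =>
      coll pl a b t == coll ls (nth 0 m a) (nth 0 m b) (nth 0 m t)) (iota 0 b)) (iota 0 t))
    (iota 0 np)].

Section Embed.
Variables (k : nat) (ls : seq (seq nat)) (check : seq nat -> bool).

Fixpoint embed (tab : seq (seq nat)) (n : nat) (cols : seq nat) (steps : seq embed_step)
    (m : seq nat) : bool :=
  if steps is (col, o, tests) :: steps' then
    some (fun y =>
      if occurs y m then false else if ~~ eqn (nth 0 cols y) col then false else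
      if every (fun '(a, b, v) =>
           let r := list_at tab (nth 0 m a) in
           let i := nth 0 r (nth 0 m b) in
           if eqn i n then ~~ v else if eqn i (nth 0 r y) then v else ~~ v) tests
      then embed tab n cols steps' (rcons m y) else false)
    (if o is Some (a, b)
     then list_at ls (nth 0 (list_at tab (nth 0 m a)) (nth 0 m b)) else iota 0 k)
  else check m.

Lemma embed_check tab n cols steps m :
  embed tab n cols steps m -> exists m', check m'.
Proof.
elim: steps m => [|[[col o] tests] steps IH] m /=; first by exists m.
rewrite someE => /hasP[y _]; do 3!case: ifP => _ //; exact: IH.
Qed.
End Embed.

Definition pattern := (nat * seq (seq nat))%type.

Definition recognize (k : nat) (pats : seq (pattern * seq embed_step))
    (ls : seq (seq nat)) : bool :=
  let tab := line_table k ls in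
  let n := size ls in
  let cols := mkseq (color k tab n ls) k in
  some (fun ps => let: ((np, pl), steps) := ps in
    if eqn np k then if eqn (size pl) n
    then embed k ls (induced np pl ls k) tab n cols steps [::] else false else false) pats.

Definition with_plan (p : pattern) := (p, plan p.1 p.2).

Lemma recognize_sound k ps ls : recognize k (map with_plan ps) ls ->
  exists2 p : pattern, p \in ps & exists m, induced p.1 p.2 ls k m.
Proof.
rewrite /recognize someE => /hasP[[[np pl] steps]] /mapP[p pps [Ep _]].
case: ifP => // _; case: ifP => // _ /embed_check[m hm].
by exists p => //; exists m; rewrite -Ep.
Qed.

(* Every point of these patterns lies on at least three lines. In the patterns for which
   coordinates are computed, the points 0, 1, 3 are a frame and 012, 034 are lines; [golden] and
   [maclane9] start with points that lie on four lines, to shorten the search. The patterns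
   [maclane9], [maclane11] (named after their number of lines) and [hesse] contain [maclane], and
   [pappus], [nine3_2], [nine3_3] are the three configurations 9_3. *)
Definition fano : pattern :=
  (7, [:: [:: 0; 1; 2]; [:: 0; 3; 4]; [:: 0; 5; 6]; [:: 1; 3; 5]; [:: 1; 4; 6];
          [:: 2; 3; 6]; [:: 2; 4; 5]]).
Definition maclane : pattern :=
  (8, [:: [:: 0; 1; 3]; [:: 1; 2; 4]; [:: 2; 3; 5]; [:: 3; 4; 6]; [:: 4; 5; 7];
          [:: 5; 6; 0]; [:: 6; 7; 1]; [:: 7; 0; 2]]).
Definition maclane9 : pattern :=
  (9, [:: [:: 2; 3; 4; 7]; [:: 2; 5; 6; 8]; [:: 2; 0; 1]; [:: 3; 6; 0]; [:: 3; 1; 8];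
          [:: 4; 5; 0]; [:: 4; 6; 1]; [:: 5; 1; 7]; [:: 0; 7; 8]]).
Definition maclane11 : pattern :=
  (9, [:: [:: 0; 1; 2]; [:: 0; 3; 4]; [:: 0; 5; 6]; [:: 0; 7; 8]; [:: 1; 4; 5];
          [:: 1; 6; 7]; [:: 2; 3; 6]; [:: 2; 4; 7]; [:: 2; 5; 8]; [:: 3; 5; 7]; [:: 4; 6; 8]]).
Definition hesse : pattern :=
  (9, [:: [:: 0; 1; 2]; [:: 0; 3; 4]; [:: 0; 5; 6]; [:: 0; 7; 8]; [:: 1; 3; 5];
          [:: 1; 4; 7]; [:: 1; 6; 8]; [:: 2; 3; 8]; [:: 2; 4; 6]; [:: 2; 5; 7];
          [:: 3; 6; 7]; [:: 4; 5; 8]]).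
Definition golden : pattern :=
  (9, [:: [:: 1; 3; 5; 7]; [:: 1; 2; 0]; [:: 1; 6; 8]; [:: 3; 2; 4]; [:: 3; 6; 0];
          [:: 5; 6; 4]; [:: 5; 8; 0]; [:: 7; 2; 8]; [:: 7; 4; 0]]).
Definition gaussian : pattern :=
  (9, [:: [:: 0; 1; 6]; [:: 0; 2; 4]; [:: 0; 3; 8]; [:: 0; 5; 7]; [:: 1; 3; 5];
          [:: 1; 7; 8]; [:: 2; 3; 6]; [:: 2; 5; 8]; [:: 3; 4; 7]; [:: 4; 5; 6]]).
Definition pappus : pattern :=
  (9, [:: [:: 0; 1; 2]; [:: 0; 3; 4]; [:: 0; 5; 6]; [:: 1; 4; 7]; [:: 1; 6; 8];
          [:: 2; 3; 8]; [:: 2; 5; 7]; [:: 3; 6; 7]; [:: 4; 5; 8]]).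
Definition nine3_2 : pattern :=
  (9, [:: [:: 1; 7; 3]; [:: 1; 0; 2]; [:: 1; 4; 6]; [:: 7; 4; 8]; [:: 7; 6; 5];
          [:: 3; 0; 4]; [:: 3; 2; 5]; [:: 0; 8; 5]; [:: 2; 6; 8]]).
Definition nine3_3 : pattern :=
  (9, [:: [:: 2; 0; 1]; [:: 2; 5; 7]; [:: 2; 4; 8]; [:: 0; 4; 3]; [:: 0; 8; 6];
          [:: 1; 5; 3]; [:: 1; 7; 6]; [:: 5; 4; 6]; [:: 7; 8; 3]]).
Definition ten_linear : pattern :=
  (9, [:: [:: 5; 8; 2]; [:: 5; 0; 6]; [:: 5; 3; 1]; [:: 5; 4; 7]; [:: 8; 6; 3];
          [:: 8; 1; 4]; [:: 2; 0; 1]; [:: 2; 3; 7]; [:: 0; 3; 4]; [:: 6; 1; 7]]).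
Definition ten_char2 : pattern :=
  (9, [:: [:: 5; 7; 2]; [:: 5; 8; 0]; [:: 5; 3; 1]; [:: 5; 6; 4]; [:: 7; 3; 6];
          [:: 7; 1; 4]; [:: 2; 8; 3]; [:: 2; 0; 1]; [:: 8; 1; 6]; [:: 0; 3; 4]]).

Definition patterns := [:: fano; maclane; maclane11; maclane9; hesse; golden; gaussian;
  nine3_3; nine3_2; ten_linear; ten_char2; pappus].

(** A rich point with its three pairs makes seven points, so only 7, 8 and 9 occur. Each level
    settles at least one of at most 36 pairs, which makes 40 levels sufficient. *)
Lemma search7 : search 7 (recognize 7 (map with_plan patterns)) 40 [::] (uncovered0 7).
Proof. by vm_compute. Qed.
Lemma search8 : search 8 (recognize 8 (map with_plan patterns)) 40 [::] (uncovered0 8).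
Proof. by vm_compute. Qed.
Lemma search9 : search 9 (recognize 9 (map with_plan patterns)) 40 [::] (uncovered0 9).
Proof. by vm_compute. Qed.

Lemma search789 k : [|| k == 7, k == 8 | k == 9] ->
  search k (recognize k (map with_plan patterns)) 40 [::] (uncovered0 k).
Proof. by case/or3P => /eqP ->; [apply search7|apply search8|apply search9]. Qed.

Theorem rich_pattern (T : eqType) (S : seq T) (c : T -> T -> T -> bool) :
  uniq S -> size S <= 9 ->
  (forall x y z, c x y z = c y x z) -> (forall x y z, c x y z = c x z y) ->
  (forall x y, c x x y) ->
  (forall x y z t, x != y -> c x y z -> c x y t -> c x z t) ->
  (forall x, x \in S -> rich (fun y => y \in S) c x) ->
  forall x0, x0 \in S ->
  exists2 p : pattern, p \in patterns & exists m, [/\ size m = p.1, uniq m &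
    forall a b t, a < b < t -> t < p.1 ->
      c (nth x0 m a) (nth x0 m b) (nth x0 m t) = coll p.2 a b t].
Proof.
move=> uS S9 cC cCA cxx c_trans hrich x0 x0S.
have [a1 [b1 [a2 [b2 [a3 [b3 []]]]]]] := hrich _ x0S.
set s0 := [:: a1; b1; a2; b2; a3; b3] => /allP hs0' /and3P[ab1 ab2 ab3].
have hs0 y : y \in s0 -> (y \in S) && (y != x0) by exact: hs0'.
move=> /and3P[c1 c2 c3] /and3P[n12 n13 n23].
have dis a b a' b' : b \in s0 -> c x0 a b -> c x0 a' b' -> ~~ c x0 a a' ->
    [&& a != a', a != b', b != a' & b != b'].
  move=> /hs0 /andP[_ bx].
  by apply: (@disjoint_pairs _ predT _ cC cCA cxx) => // x y z t _ _; exact: c_trans.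
have m1 : b1 \in s0 by rewrite !inE eqxx orbT.
have m2 : b2 \in s0 by rewrite !inE eqxx !orbT.
have /and4P[d1 d2 d3 d4] := dis _ _ _ _ m1 c1 c2 n12.
have /and4P[d5 d6 d7 d8] := dis _ _ _ _ m1 c1 c3 n13.
have /and4P[d9 d10 d11 d12] := dis _ _ _ _ m2 c2 c3 n23.
have us0 : uniq (x0 :: s0).
  have x0s : x0 \notin s0 by apply/negP => /hs0; rewrite eqxx andbF.
  rewrite cons_uniq x0s /= !inE !negb_or.
  by rewrite ab1 ab2 ab3 d1 d2 d3 d4 d5 d6 d7 d8 d9 d10 d11 d12.
(* In this order [x0] has index 0 and the pairs on its three lines have indices 1 2, 3 4 and 5 6,
   the numbering that [known_lines] presupposes. *)
pose s := (x0 :: s0) ++ [seq x <- S | x \notin x0 :: s0].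
have sS : perm_eq s S.
  apply: uniq_perm => //.
    rewrite cat_uniq us0 filter_uniq // andbT; apply/hasPn => x.
    by rewrite mem_filter => /andP[].
  move=> x; rewrite mem_cat mem_filter; case: (boolP (x \in x0 :: s0)) => //=.
  by rewrite inE => /predU1P[->|/hs0 /andP[->]] //; rewrite x0S.
have us : uniq s by rewrite (perm_uniq sS).
have sz : size s <= 9 by rewrite (perm_size sS).
have s6 : 6 < size s by rewrite size_cat leq_addr.
pose cn x y z := c (nth x0 s x) (nth x0 s y) (nth x0 s z).
have hr x : x < size s -> rich (gtn (size s)) cn x.
  move=> xs; have xS : nth x0 s x \in S by rewrite -(perm_mem sS) mem_nth.
  have [u1 [v1 [u2 [v2 [u3 [v3 [/allP hu' hn hc hnc]]]]]]] := hrich _ xS.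
  have hu y : y \in [:: u1; v1; u2; v2; u3; v3] -> (y \in S) && (y != nth x0 s x).
    exact: hu'.
  have idx y : y \in [:: u1; v1; u2; v2; u3; v3] -> nth x0 s (index y s) = y.
    by move=> /hu /andP[yS _]; rewrite nth_index // (perm_mem sS).
  have idxE y : y \in [:: u1; v1; u2; v2; u3; v3] ->
      (index y s < size s) && (index y s != x).
    move=> yu; have /andP[yS yx] := hu y yu; rewrite index_mem (perm_mem sS) yS /=.
    by apply: contra_neq yx => <-; rewrite idx.
  exists (index u1 s), (index v1 s), (index u2 s), (index v2 s), (index u3 s), (index v3 s).
  split.
  - by rewrite /= !idxE // !inE eqxx ?orbT.
  - case/and3P: hn => hn1 hn2 hn3.
    by apply/and3P; split; [apply: contra_neq hn1|apply: contra_neq hn2|apply: contra_neq hn3];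
      move=> /(congr1 (nth x0 s)); rewrite !idx // !inE eqxx ?orbT.
  - by rewrite /cn !idx // !inE eqxx ?orbT.
  - by rewrite /cn !idx // !inE eqxx ?orbT.
have cn_trans x y z t : gtn (size s) x -> gtn (size s) y -> x != y ->
    cn x y z -> cn x y t -> cn x z t.
  by move=> xs ys xy; apply: c_trans; rewrite nth_uniq.
have pos : [&& cn 0 1 2, cn 0 3 4 & cn 0 5 6] by rewrite /cn /= c1 c2 c3.
have neg : [&& ~~ cn 0 1 3, ~~ cn 0 1 5 & ~~ cn 0 3 5] by rewrite /cn /= n12 n13 n23.
have k789 : [|| size s == 7, size s == 8 | size s == 9] by move: sz s6; clear; lia.
have hsearch : search (size s) (recognize (size s) (map with_plan patterns)) 40 [::]
    (uncovered0 (size s)).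
  by apply (search789 k789).
have [ls lf hls] := search_sound (fun x y z => cC _ _ _) (fun x y z => cCA _ _ _)
  (fun x y => cxx _ _) cn_trans s6 pos neg hr (inv0 _ _) hsearch.
have [p pp [m /and4P[/eqP szm um /allP mk /allP hm]]] := recognize_sound lf.
exists p => //; exists (map (nth x0 s) m); split.
- by rewrite size_map.
- rewrite map_inj_in_uniq // => i j /mk ik /mk jk /eqP; rewrite nth_uniq //.
  by move/eqP.
- move=> a b t /andP[ab bt] tp; have bp := ltn_trans bt tp; have ap := ltn_trans ab bp.
  rewrite !(nth_map 0) ?szm //.
  have iotaP x y : x < y -> x \in iota 0 y by rewrite mem_iota.
  have /allP/(_ _ (iotaP _ _ bt))/allP/(_ _ (iotaP _ _ ab))/eqP -> := hm _ (iotaP _ _ tp).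
  apply: hls; rewrite ?nth_uniq ?szm //;
    rewrite ?(ltn_eqF ab) ?(ltn_eqF bt) ?(ltn_eqF (ltn_trans ab bt)) //;
    by apply: mk; rewrite mem_nth // szm.
Qed.

Local Open Scope ring_scope.


(** * Vectors and lattices *)

Definition o0 : 'I_3 := @Ordinal 3 0 isT.
Definition o1 : 'I_3 := @Ordinal 3 1 isT.
Definition o2 : 'I_3 := @Ordinal 3 2 isT.

Lemma ord3P (P : 'I_3 -> Prop) : P o0 -> P o1 -> P o2 -> forall i, P i.
Proof.
move=> h0 h1 h2 [[|[|[|//]]] h].
- by rewrite (_ : Ordinal h = o0) //; exact: val_inj.
- by rewrite (_ : Ordinal h = o1) //; exact: val_inj.
- by rewrite (_ : Ordinal h = o2) //; exact: val_inj.
Qed.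

Lemma sum3 (V : nmodType) (F : 'I_3 -> V) : \sum_i F i = F o0 + F o1 + F o2.
Proof.
rewrite !big_ord_recl big_ord0 addr0 addrA.
by congr (F _ + F _ + F _); apply: val_inj.
Qed.

Definition row3 (R : nzRingType) (a b c : R) : 'rV[R]_3 := \row_(j < 3) [:: a; b; c]`_j.

Lemma rowP3 (R : nzRingType) (u v : 'rV[R]_3) :
  u 0 o0 = v 0 o0 -> u 0 o1 = v 0 o1 -> u 0 o2 = v 0 o2 -> u = v.
Proof. by move=> h0 h1 h2; apply/rowP; apply: ord3P. Qed.

Lemma row_neq0 (R : nzRingType) n (u : 'rV[R]_n) : u != 0 -> exists j, u 0 j != 0.
Proof.
move=> u0; apply/existsP; apply: contraNT u0 => /existsPn h; apply/eqP/rowP => j.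
by rewrite [RHS]mxE; apply/eqP; have := h j; rewrite negbK.
Qed.

Section Det3.
Variable R : comNzRingType.
Implicit Types a b c p q u v w : 'rV[R]_3.

Definition det3 u v w : R :=
  u 0 o0 * (v 0 o1 * w 0 o2 - v 0 o2 * w 0 o1)
  - u 0 o1 * (v 0 o0 * w 0 o2 - v 0 o2 * w 0 o0)
  + u 0 o2 * (v 0 o0 * w 0 o1 - v 0 o1 * w 0 o0).

Definition cross u v : 'rV[R]_3 :=
  row3 (u 0 o1 * v 0 o2 - u 0 o2 * v 0 o1)
       (u 0 o2 * v 0 o0 - u 0 o0 * v 0 o2)
       (u 0 o0 * v 0 o1 - u 0 o1 * v 0 o0).

Lemma det3_swap12 u v w : det3 v u w = - det3 u v w.
Proof. rewrite /det3; ring. Qed.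

Lemma det3_swap23 u v w : det3 u w v = - det3 u v w.
Proof. rewrite /det3; ring. Qed.

Lemma det3_uuv u v : det3 u u v = 0.
Proof. rewrite /det3; ring. Qed.

Lemma det3_uvv u v : det3 v u u = 0.
Proof. rewrite /det3; ring. Qed.

Lemma det3_uvu u v : det3 u v u = 0.
Proof. rewrite /det3; ring. Qed.

Lemma det3Z x y z u v w : det3 (x *: u) (y *: v) (z *: w) = x * y * z * det3 u v w.
Proof. rewrite /det3 !mxE; ring. Qed.

Lemma det3_linear3 x y u v w w' : det3 u v (x *: w + y *: w') = x * det3 u v w + y * det3 u v w'.
Proof. rewrite /det3 !mxE; ring. Qed.

Lemma det3_mul (G : 'M[R]_3) u v w :
  det3 (u *m G) (v *m G) (w *m G) = det3 u v w * det3 (row o0 G) (row o1 G) (row o2 G).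
Proof. rewrite /det3 !mxE !sum3; ring. Qed.

(** Cramer's rule without division: the linear relation between four vectors in dimension three,
    with minors as coefficients. *)
Lemma four_vectors u v w p :
  det3 u v p *: w = det3 u v w *: p + det3 u w p *: v - det3 v w p *: u.
Proof. by apply: rowP3; rewrite /det3 !mxE; ring. Qed.

Lemma cross_dot u v w : (cross u v *m w^T) 0 0 = det3 u v w.
Proof. rewrite !mxE sum3 !mxE /det3 /=; ring. Qed.

Lemma cross_neq0P u v : cross u v != 0 -> exists w, det3 u v w != 0.
Proof.
move=> n0; case: (eqVneq (cross u v 0 o0) 0) => [e0|]; last first.
  move=> h; exists (row3 1 0 0); apply: contra_neq h; rewrite /det3 !mxE /= => <-; ring.
case: (eqVneq (cross u v 0 o1) 0) => [e1|]; last first.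
  move=> h; exists (row3 0 1 0); apply: contra_neq h; rewrite /det3 !mxE /= => <-; ring.
exists (row3 0 0 1); apply: contra_neq n0 => e2; apply: rowP3; rewrite ?e0 ?e1 ?mxE //=.
by move: e2; rewrite /det3 !mxE /= => <-; ring.
Qed.

Lemma det3_cross_neq0 u v w : det3 u v w != 0 -> cross u v != 0.
Proof. by apply: contra_neq => c0; rewrite -cross_dot c0 mul0mx mxE. Qed.
End Det3.

(** The multiples of [u], [v], [w] by [det3 a b q] lie in the span of [a] and [b]. An integral
    domain suffices, so that this also applies to the polynomial points of a curve. *)
Lemma det3_coplanar (R : idomainType) (a b q u v w : 'rV[R]_3) : det3 a b q != 0 ->
  det3 a b u = 0 -> det3 a b v = 0 -> det3 a b w = 0 -> det3 u v w = 0.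
Proof.
move=> D0 hu hv hw; have := four_vectors a b u q; have := four_vectors a b v q.
have := four_vectors a b w q; rewrite hu hv hw !scale0r !add0r => ew ev eu.
have : det3 (det3 a b q *: u) (det3 a b q *: v) (det3 a b q *: w) = 0.
  by rewrite ew ev eu /det3 !mxE; ring.
rewrite det3Z => /eqP; rewrite !mulf_eq0 !(negPf D0) /= => /eqP //.
Qed.

Section Span.
Variable K : fieldType.
Implicit Types a b c p q u v w : 'rV[K]_3.

Lemma det3_span a b p : cross a b != 0 -> det3 a b p = 0 -> exists s t, p = s *: a + t *: b.
Proof.
case/cross_neq0P => q D0 h; have := four_vectors a b p q; rewrite h scale0r add0r => e.
exists (- det3 b p q / det3 a b q), (det3 a p q / det3 a b q).
apply: (scalerI D0); rewrite e scalerDr !scalerA !(mulrCA (det3 a b q)) mulfV // !mulr1.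
by rewrite scaleNr addrC.
Qed.

Lemma cross_eq0_prop u v : u != 0 -> cross u v = 0 -> exists k, v = k *: u.
Proof.
move=> u0 c0.
have e01 : u 0 o0 * v 0 o1 = u 0 o1 * v 0 o0.
  by apply/eqP; rewrite -subr_eq0; move/rowP/(_ o2): c0; rewrite !mxE /= => ->.
have e12 : u 0 o1 * v 0 o2 = u 0 o2 * v 0 o1.
  by apply/eqP; rewrite -subr_eq0; move/rowP/(_ o0): c0; rewrite !mxE /= => ->.
have e20 : u 0 o2 * v 0 o0 = u 0 o0 * v 0 o2.
  by apply/eqP; rewrite -subr_eq0; move/rowP/(_ o1): c0; rewrite !mxE /= => ->.
have [m um] := row_neq0 u0.
exists (v 0 m / u 0 m); apply/rowP => j; rewrite mxE.
have -> : v 0 m / u 0 m * u 0 j = u 0 j * v 0 m / u 0 m by ring.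
apply: (mulIf um); rewrite divfK // mulrC.
by move: m j {um}; apply: ord3P; apply: ord3P; rewrite ?e01 ?e12 ?e20.
Qed.
(* Triple product expansion: [(u x v) x w = (u . w) v - (v . w) u]. *)
Lemma orth_cross u v w : cross u v != 0 -> w *m u^T = 0 -> w *m v^T = 0 ->
  exists k, w = k *: cross u v.
Proof.
move=> n0 /(congr1 (fun M : 'M_1 => M 0 0)) hu /(congr1 (fun M : 'M_1 => M 0 0)) hv.
apply: cross_eq0_prop n0 _.
have -> : cross (cross u v) w = (w *m u^T) 0 0 *: v - (w *m v^T) 0 0 *: u.
  by apply: rowP3; rewrite !mxE /= !sum3 !mxE; ring.
by rewrite hu hv !mxE !scale0r subr0.
Qed.
End Span.

Section Collinear.
Variable K : fieldType.

Definition col n (A : config K n) (i j k : 'I_n) : bool :=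
  det3 (hcoords (A i)) (hcoords (A j)) (hcoords (A k)) == 0.

Lemma colC n (A : config K n) i j k : col A i j k = col A j i k.
Proof. by rewrite /col det3_swap12 oppr_eq0. Qed.

Lemma colCA n (A : config K n) i j k : col A i j k = col A i k j.
Proof. by rewrite /col det3_swap23 oppr_eq0. Qed.

Lemma col_iij n (A : config K n) i j : col A i i j.
Proof. by rewrite /col det3_uuv. Qed.

Lemma col_iji n (A : config K n) i j : col A i j i.
Proof. by rewrite colCA col_iij. Qed.

Lemma col_ijj n (A : config K n) i j : col A i j j.
Proof. by rewrite colC col_iji. Qed.

Lemma cross_hcoords (a b : proj_plane K) : a != b -> cross (hcoords a) (hcoords b) != 0.
Proof.
apply: contra_neq => /(cross_eq0_prop (hcoords_neq0 a)) [k kE].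
apply: val_inj => /=; rewrite (hcoordsE a) (hcoordsE b) kE.
have k0 : k != 0 by apply: contraNneq (hcoords_neq0 b) => k0; rewrite kE k0 scale0r.
apply/eqP; rewrite eqEdim !dim_vline scaler_eq0 (negPf k0) hcoords_neq0 leqnn andbT.
by rewrite -memvE; apply/vlineP; exists k^-1; rewrite scalerA mulVf ?scale1r.
Qed.

Lemma col_trans n (A : config K n) : is_arrangement A -> forall i j k l,
  i != j -> col A i j k -> col A i j l -> col A i k l.
Proof.
move=> Ainj i j k l ij /eqP hk /eqP hl.
have /cross_hcoords/cross_neq0P [q D0] : A i != A j by rewrite (inj_eq Ainj).
by apply/eqP/(det3_coplanar D0); rewrite ?det3_uvu.
Qed.

Lemma dim_line (a : proj_plane K) : \dim (line a) = 2%N.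
Proof.
pose f : 'Hom('rV[K]_3, 'M[K]_1) := linfun (mulmxr (hcoords a)^T).
have := limg_ker_dim f fullv; rewrite capfv dimvf /dim /= -/(line a).
suff -> : (\dim (limg f) = 1)%N by rewrite addn1 => -[].
apply/eqP; rewrite eqn_leq; apply/andP; split.
  by apply: leq_trans (dimvS (subvf _)) _; rewrite dimvf.
rewrite lt0n dimv_eq0; apply: contraNneq (hcoords_neq0 a) => im0.
apply/eqP/rowP => j; rewrite mxE.
have : f (delta_mx 0 j) \in 0%VS by rewrite -im0 memv_img ?memvf.
by rewrite memv0 lfunE /= -rowE => /eqP/matrixP/(_ 0 0); rewrite !mxE.
Qed.

(** Two distinct lines meet in the point spanned by the cross product, so the intersection is that
    point or empty. The whole lattice is thereby encoded in the relation [col]. *)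
Lemma dim_meet n (A : config K n) (S : {set 'I_n}) i j : is_arrangement A ->
  i \in S -> j \in S -> i != j ->
  \dim (\bigcap_(k in S) line (A k))%VS = [forall k in S, col A i j k] :> nat.
Proof.
move=> Ainj iS jS ij; set n_ := cross (hcoords (A i)) (hcoords (A j)).
have n0 : n_ != 0 by rewrite cross_hcoords // (inj_eq Ainj).
have memW v : (v \in \bigcap_(k in S) line (A k))%VS = [forall k in S, v *m (hcoords (A k))^T == 0].
  apply/subv_bigcapP/forall_inP => h k kS.
    by rewrite -mem_line memvE h.
  by rewrite -memvE mem_line h.
have sub : (\bigcap_(k in S) line (A k) <= <[n_]>)%VS.
  apply/subvP => v; rewrite memW => /forall_inP h; apply/vlineP.
  by apply: orth_cross => //; apply/eqP/h.
have nW : (n_ \in \bigcap_(k in S) line (A k))%VS = [forall k in S, col A i j k].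
  rewrite memW; apply: eq_forallb => k; congr (_ ==> _).
  rewrite /col -cross_dot; apply/eqP/eqP => [->|h]; first by rewrite mxE.
  by apply/matrixP => x y; rewrite !ord1 h mxE.
case: (boolP [forall k in S, col A i j k]) => h; move: nW; rewrite ?h ?(negPf h) => nW.
  rewrite (_ : (\bigcap_(k in S) line (A k))%VS = <[n_]>%VS) ?dim_vline ?n0 //.
  by apply/eqP; rewrite eqEsubv sub -memvE.
apply/eqP; rewrite dimv_eq0 -subv0; apply/subvP => v vW.
have /vlineP[k kE] := subvP sub _ vW.
have [k0|k0] := eqVneq k 0; first by rewrite kE k0 scale0r mem0v.
suff : false by []; rewrite -nW.
by rewrite (_ : n_ = k^-1 *: v) ?memvZ // kE scalerA mulVf ?scale1r.
Qed.

Lemma dim_meet_perm n (A B : config K n) (phi : 'S_n) :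
  is_arrangement A -> is_arrangement B ->
  (forall i j k, i != j -> i != k -> j != k -> col B (phi i) (phi j) (phi k) = col A i j k) ->
  forall S : {set 'I_n}, S != finset.set0 ->
    \dim (\bigcap_(i in S) line (A i))%VS =
    \dim (\bigcap_(j in (phi @: S)%SET) line (B j))%VS.
Proof.
move=> Ainj Binj h S /finset.set0Pn [i iS].
have [j /= /andP[jS ij]|none] := pickP [pred j | (j \in S) && (i != j)].
  rewrite (dim_meet Ainj iS jS ij).
  have pS k : (phi k \in (phi @: S)%SET) = (k \in S) by rewrite mem_imset //; exact: perm_inj.
  rewrite (@dim_meet _ _ _ (phi i) (phi j)) ?pS //; last by rewrite (inj_eq perm_inj).
  congr (nat_of_bool _); apply/forall_inP/forall_inP => H k kS.
    case/imsetP: kS => {}k kS ->; move: (H k kS).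
    have [<-|ik] := eqVneq i k; first by rewrite !col_iji.
    have [<-|jk] := eqVneq j k; first by rewrite !col_ijj.
    by rewrite h.
  have := H _ (imset_f phi kS).
  have [<-|ik] := eqVneq i k; first by rewrite !col_iji.
  have [<-|jk] := eqVneq j k; first by rewrite !col_ijj.
  by rewrite h.
have -> : S = [set i]%SET.
  apply/setP => k; rewrite finset.in_set1; apply/idP/eqP => [kS|->//].
  by have := none k; rewrite /= kS /= => /negbT; rewrite negbK => /eqP.
by rewrite imset_set1 !big_set1 !dim_line.
Qed.

Lemma same_lattice_col n (A B : config K n) : is_arrangement A -> same_lattice B A ->
  is_arrangement B /\ (forall i j k, col B i j k = col A i j k).
Proof.
move=> Ainj h.
have Binj : is_arrangement B.
  move=> i j Bij; apply/eqP; apply/idPn => ij.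
  (* Equal lines would meet in dimension 2, whereas in [A] the dimension is at most 1. *)
  have S0 : [set i; j]%SET != finset.set0 by apply/finset.set0Pn; exists i; rewrite !inE eqxx.
  have := h _ S0; rewrite (@dim_meet _ A _ i j) ?inE ?eqxx ?orbT //.
  rewrite big_setU1 ?finset.in_set1 //= big_set1 Bij capvv dim_line.
  by set b := (X in nat_of_bool X); case: b.
split=> // i j k.
have [<-|ij] := eqVneq i j; first by rewrite !col_iij.
have [<-|ik] := eqVneq i k; first by rewrite !col_iji.
have [<-|jk] := eqVneq j k; first by rewrite !col_ijj.
have S0 : [set i; j; k]%SET != finset.set0 by apply/finset.set0Pn; exists i; rewrite !inE eqxx.
have := h _ S0.
rewrite !(@dim_meet _ _ [set i; j; k]%SET i j) ?inE ?eqxx ?orbT //.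
have E C : [forall l in [set i; j; k]%SET, col C i j l] = col C i j k.
  apply/forall_inP/idP => [H|H l]; first by apply: H; rewrite !inE eqxx !orbT.
  rewrite !inE => /orP[/orP[]|] /eqP -> //; first by rewrite col_iji.
  by rewrite colC colCA col_iij.
by rewrite !E; case: (col B i j k) (col A i j k) => -[].
Qed.

Lemma col_same_lattice n (A B : config K n) : is_arrangement A -> is_arrangement B ->
  (forall i j k, i != j -> i != k -> j != k -> col B i j k = col A i j k) -> same_lattice B A.
Proof.
move=> Ainj Binj h S S0; rewrite (@dim_meet_perm _ A B 1%g) //; last first.
  by move=> i j k; rewrite !permE; exact: h.
rewrite (_ : ((1%g : 'S_n) @: S)%SET = S) //.
  by apply/setP => i; apply/imsetP/idP => [[j jS ->]|iS]; [|exists i]; rewrite ?perm1.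
Qed.
End Collinear.

Local Open Scope classical_set_scope.

(** * Irreducibility from rational curves *)

Section Curves.
Variable K : numFieldType.

Definition at_point (x : K) (P : 'rV[{poly K}]_3) : 'rV[K]_3 := \row_j (P 0 j).[x].

Lemma at_point_det3 x P Q T : det3 (at_point x P) (at_point x Q) (at_point x T) = (det3 P Q T).[x].
Proof. by rewrite /det3 !mxE !(hornerE, hornerN). Qed.

Lemma at_point_cross x P Q : at_point x (cross P Q) = cross (at_point x P) (at_point x Q).
Proof. by apply: rowP3; rewrite !mxE /= !(hornerE, hornerN). Qed.

Lemma at_pointD x P Q : at_point x (P + Q) = at_point x P + at_point x Q.
Proof. by apply/rowP => j; rewrite !mxE hornerD. Qed.

Lemma at_pointZ x p P : at_point x (p *: P) = p.[x] *: at_point x P.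
Proof. by apply/rowP => j; rewrite !mxE hornerM. Qed.

(* Any two realizations are joined by a polynomial curve along which the collinearities of [A]
   between the points of [S] persist; generic points of the curve are again realizations. *)
Definition joined n (A : config K n) (S : {set 'I_n}) : Prop :=
  forall B : bool -> config K n, (forall b, realizations A (B b)) ->
  exists P : 'I_n -> 'rV[{poly K}]_3,
    (forall b i, i \in S -> val (B b i) = <[at_point b%:R (P i)]>%VS) /\
    (forall i j k, i \in S -> j \in S -> k \in S -> col A i j k ->
       det3 (P i) (P j) (P k) = 0).

Lemma poly_nonroot (p : {poly K}) : p != 0 -> exists x, p.[x] != 0.
Proof.
move=> p0; apply: contrapT => h.
have := @max_poly_roots _ p [seq i%:R | i <- iota 0 (size p)] p0.
rewrite size_map size_iota ltnn => H; suff : false by []; apply: H.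
  apply/allP => x _; rewrite /root; apply/negPn/negP => px; apply: h; by exists x.
by rewrite map_inj_uniq ?iota_uniq // => i j /eqP; rewrite eqr_nat => /eqP.
Qed.

Lemma meval_curve n (M : 'M[{poly K}]_(n, 3)) (f : {mpoly K[(n * 3)%N]}) :
  exists q : {poly K}, forall x,
    meval_mx (\matrix_(i, j) (M i j).[x]) f = q.[x].
Proof.
exists (\sum_(m <- msupp f) f@_m *: \prod_i (mxvec M 0 i) ^+ m i) => x.
rewrite /meval_mx mevalE horner_sum; apply: eq_bigr => m _.
rewrite hornerZ horner_prod; congr (_ * _); apply: eq_bigr => k _.
rewrite horner_exp; congr (_ ^+ _).
by case/mxvec_indexP: k => i j; rewrite !mxvecE mxE.
Qed.

Lemma vline_neq0 (a : proj_plane K) v : val a = <[v]>%VS -> v != 0.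
Proof.
move=> e; apply/eqP => v0; have := hcoords_neq0 a; have := memv_pick (val a).
by rewrite {2}e v0 -/(hcoords a) memv0 => ->.
Qed.

Lemma vline_hcoords (a : proj_plane K) v :
  val a = <[v]>%VS -> exists2 k, k != 0 & v = k *: hcoords a.
Proof.
move=> e; have : v \in <[hcoords a]>%VS by rewrite -hcoordsE e memv_line.
case/vlineP => k kE; exists k => //.
by apply: contra_neq (vline_neq0 e) => k0; rewrite kE k0 scale0r.
Qed.

Lemma hcoords_vline (a : proj_plane K) v k : k != 0 -> hcoords a = k *: v -> val a = <[v]>%VS.
Proof.
move=> k0 e; rewrite (hcoordsE a) e; apply/eqP; rewrite eqEdim !dim_vline scaler_eq0 (negPf k0).
by rewrite leqnn andbT -memvE memvZ ?memv_line.
Qed.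

Definition point_of (v : 'rV[K]_3) : proj_plane K := hpoint (v 0 o0) (v 0 o1) (v 0 o2).

Lemma val_point_of v : v != 0 -> val (point_of v) = <[v]>%VS.
Proof.
have e : vec3 (v 0 o0) (v 0 o1) (v 0 o2) = v by apply: rowP3; rewrite mxE.
by move=> v0; rewrite val_hpoint e.
Qed.

Lemma col_vline n (B : config K n) (v : 'I_n -> 'rV[K]_3) :
  (forall i, val (B i) = <[v i]>%VS) ->
  forall i j k, col B i j k = (det3 (v i) (v j) (v k) == 0).
Proof.
move=> h i j k; have [a a0 ->] := vline_hcoords (h i).
have [b b0 ->] := vline_hcoords (h j); have [c c0 ->] := vline_hcoords (h k).
by rewrite det3Z !mulf_eq0 (negPf a0) (negPf b0) (negPf c0).
Qed.

(** A Zariski neighbourhood of [x0] on the parameter line, given by one polynomial so that finitely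
    many conditions combine by multiplication. *)
Definition generic (x0 : K) (Q : K -> Prop) : Prop :=
  exists q : {poly K}, q.[x0] != 0 /\ forall x, q.[x] != 0 -> Q x.

Lemma generic_all (I : finType) (x0 : K) (Q : I -> K -> Prop) :
  (forall i, generic x0 (Q i)) -> generic x0 (fun x => forall i, Q i x).
Proof.
move=> /fin_all_exists [q hq]; exists (\prod_i q i); split.
  by rewrite horner_prod prodf_seq_neq0; apply/allP => i _; exact: (hq i).1.
move=> x; rewrite horner_prod prodf_seq_neq0 => /allP h i.
by apply: (hq i).2; exact: h (mem_index_enum i).
Qed.

Lemma generic_vec (x0 : K) (v : 'rV[{poly K}]_3) :
  at_point x0 v != 0 -> generic x0 (fun x => at_point x v != 0).
Proof.
move=> /row_neq0 [j hj].
exists (v 0 j); rewrite mxE in hj; split=> // x; apply: contra_neq => /rowP/(_ j).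
by rewrite !mxE.
Qed.

Lemma generic_true (x0 : K) (Q : K -> Prop) : (forall x, Q x) -> generic x0 Q.
Proof. by move=> h; exists 1; split=> [|x _]; rewrite ?hornerC ?oner_eq0. Qed.

(** Collinearities are identities along the curve. The other requirements, namely non-zero vectors,
    distinct points and non-collinear triples, are open and hold at [x0]. *)
Lemma curve_generic n (A : config K n) (P : 'I_n -> 'rV[{poly K}]_3) x0 B0 :
  is_arrangement A ->
  (forall i j k, col A i j k -> det3 (P i) (P j) (P k) = 0) ->
  realizations A B0 -> (forall i, val (B0 i) = <[at_point x0 (P i)]>%VS) ->
  generic x0 (fun x => exists2 B, realizations A B &
    forall i, val (B i) = <[at_point x (P i)]>%VS).
Proof.
move=> Ainj hcol B0A B0P; have [B0inj colB0] := same_lattice_col Ainj B0A.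
have g1 : generic x0 (fun x => forall i, at_point x (P i) != 0).
  by apply: generic_all => i; apply: generic_vec; exact: vline_neq0 (B0P i).
have g2 : generic x0 (fun x => forall ij : 'I_n * 'I_n, ij.1 != ij.2 ->
    cross (at_point x (P ij.1)) (at_point x (P ij.2)) != 0).
  apply: generic_all => -[i j] /=; have [<-|ij] := eqVneq i j.
    by apply: generic_true => x; rewrite ?eqxx.
  have [|q [q0 hq]] := @generic_vec x0 (cross (P i) (P j)).
    rewrite at_point_cross; have : B0 i != B0 j by rewrite (inj_eq B0inj).
    move/cross_hcoords; have [a a0 ->] := vline_hcoords (B0P i).
    have [b b0 ->] := vline_hcoords (B0P j).
    case/cross_neq0P => w hw; apply: (@det3_cross_neq0 _ _ _ w).
    by rewrite -[w]scale1r det3Z mulr1 !mulf_neq0.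
  by exists q; split=> // x /hq; rewrite at_point_cross.
have g3 : generic x0 (fun x => forall t : 'I_n * 'I_n * 'I_n, ~~ col A t.1.1 t.1.2 t.2 ->
    det3 (at_point x (P t.1.1)) (at_point x (P t.1.2)) (at_point x (P t.2)) != 0).
  apply: generic_all => -[[i j] k] /=; have [cl|ncl] := boolP (col A i j k).
    by apply: generic_true => x.
  exists (det3 (P i) (P j) (P k)); split=> [|x h _]; last by rewrite at_point_det3.
  by rewrite -at_point_det3 -(col_vline B0P) colB0.
case: g1 g2 g3 => q1 [q1x h1] [q2 [q2x h2]] [q3 [q3x h3]].
exists (q1 * q2 * q3); rewrite !hornerM !mulf_neq0 //; split=> // x.
rewrite !hornerM !mulf_eq0 !negb_or => /andP[/andP[/h1 {}h1 /h2 {}h2] /h3 {}h3].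
pose B : config K n := [ffun i => point_of (at_point x (P i))].
have BP i : val (B i) = <[at_point x (P i)]>%VS by rewrite ffunE val_point_of.
exists B => //; apply: col_same_lattice => //.
  move=> i j Bij; apply/eqP; apply/idPn => ij.
  have := h2 (i, j) ij; rewrite /=.
  have : at_point x (P j) \in <[at_point x (P i)]>%VS by rewrite -BP Bij BP memv_line.
  case/vlineP => k ->; apply/negP; rewrite negbK; apply/eqP.
  by apply: rowP3; rewrite !mxE /=; ring.
move=> i j k ij ik jk; rewrite (col_vline BP).
case: (boolP (col A i j k)) => [/hcol h|]; last by move/(h3 (i, j, k))/negPf.
by rewrite at_point_det3 h horner0 eqxx.
Qed.

Lemma open_moduli n (A : config K n) (U : set (moduli_space A)) : open U ->
  exists2 F, F `<=` @multihomogeneous K n & forall x : realizations A,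
    U (\pi_(moduli_space A)%qT x) <-> ~ zero_locus F (val x).
Proof.
move=> -[V [F hF ->] VU]; exists F => // x.
have : (val @^-1` (~` zero_locus F)) x <-> U (\pi_(moduli_space A)%qT x) by rewrite VU.
by case=> h1 h2; split => [/h2|/h1].
Qed.

(** Polynomials [f] and [g] witness that one class is outside [F] and another outside [G]. On a
    curve through representatives, [f] is non-zero at 0 and [g] at 1, so at a generic parameter both
    are non-zero, and the realization there has its class outside both sets. *)
Lemma joined_irreducible n (A : config K n) : is_arrangement A ->
  joined A finset.setT -> irreducible_space (moduli_space A).
Proof.
move=> Ainj J.
have AA : realizations A A by [].
split; first by exists (\pi_(moduli_space A)%qT (exist _ A (mem_set AA))).
move=> F G cF cG FG; apply: contrapT => /not_orP[nF nG].
have out (H : set (moduli_space A)) : H <> setT -> exists x, ~ H x.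
  move=> nH; apply: contrapT => h; apply: nH; apply/seteqP; split => // x _.
  by apply: contrapT => nx; apply: h; exists x.
have [x0 Fx0] := out _ nF; have [x1 Gx1] := out _ nG.
have [SF hSF FE] := open_moduli (closed_openC cF).
have [SG hSG GE] := open_moduli (closed_openC cG).
pose r0 : realizations A := repr x0; pose r1 : realizations A := repr x1.
have /existsNP [f /not_implyP [Ff f0]] : ~ zero_locus SF (val r0).
  by apply/FE; rewrite /r0 reprK.
have /existsNP [g /not_implyP [Gg g0]] : ~ zero_locus SG (val r1).
  by apply/GE; rewrite /r1 reprK.
have [|P [PB Pcol]] := J (fun b => val (if b then r1 else r0)).
  by move=> b; exact: set_valP.
have {}PB b i : val (val (if b then r1 else r0) i) = <[at_point b%:R (P i)]>%VS.
  by apply: PB; rewrite inE.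
have {}Pcol i j k : col A i j k -> det3 (P i) (P j) (P k) = 0.
  by apply: Pcol; rewrite inE.
pose M := \matrix_(i, j) P i 0 j.
have rowM x i : row i (\matrix_(i, j) (M i j).[x]) = at_point x (P i).
  by apply/rowP => j; rewrite !mxE.
have van x (B : config K n) h : (forall i, val (B i) = <[at_point x (P i)]>%VS) ->
    multihomogeneous h -> vanishes_at h B <-> meval_mx (\matrix_(i, j) (M i j).[x]) h = 0.
  by move=> BP hh; apply: vanishes_atP => // i; rewrite rowM BP.
have [qf hqf] := meval_curve M f; have [qg hqg] := meval_curve M g.
have qf0 : qf.[0] != 0.
  by rewrite -hqf; apply/eqP => /(van _ _ _ (PB false) (hSF _ Ff)); exact: f0.
have qg0 : qg.[1] != 0.
  by rewrite -hqg; apply/eqP => /(van _ _ _ (PB true) (hSG _ Gg)); exact: g0.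
have [q [q0 hq]] := curve_generic Ainj Pcol (set_valP r0) (PB false).
have [x] : exists x, (q * qf * qg).[x] != 0.
  apply: poly_nonroot; rewrite !mulf_neq0 //.
  - by apply: contraNneq q0 => ->; rewrite horner0.
  - by apply: contraNneq qf0 => ->; rewrite horner0.
  - by apply: contraNneq qg0 => ->; rewrite horner0.
rewrite !hornerM !mulf_eq0 !negb_or => /andP[/andP[/hq [B BA BP] fx] gx].
pose rB : realizations A := exist _ B (mem_set BA).
have : (F `|` G) (\pi_(moduli_space A)%qT rB) by rewrite FG.
case=> [FB|GB].
  have : ~ (~` F) (\pi_(moduli_space A)%qT rB) by move/(_ FB).
  move/FE/contrapT/(_ _ Ff) => /(van _ _ _ BP (hSF _ Ff)) h.
  by move/eqP: fx; apply; rewrite -hqf.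
have : ~ (~` G) (\pi_(moduli_space A)%qT rB) by move/(_ GB).
move/GE/contrapT/(_ _ Gg) => /(van _ _ _ BP (hSG _ Gg)) h.
by move/eqP: gx; apply; rewrite -hqg.
Qed.
End Curves.


(** * Adding a point on at most two lines *)

Section Steps.
Variable K : numFieldType.

Definition interp (x : bool -> K) : {poly K} := (x false)%:P + (x true - x false) *: 'X.

Lemma interpE x (b : bool) : (interp x).[b%:R] = x b.
Proof. by rewrite /interp !hornerE; case: b => /=; ring. Qed.

Definition interpv (v : bool -> 'rV[K]_3) : 'rV[{poly K}]_3 := \row_j interp (fun b => v b 0 j).

Lemma interpvE v (b : bool) : at_point b%:R (interpv v) = v b.
Proof. by apply/rowP => j; rewrite !mxE interpE. Qed.

Variables (n : nat) (A : config K n).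
Hypothesis Ainj : is_arrangement A.
Implicit Types S : {set 'I_n}.

Lemma joined_set0 : joined A finset.set0.
Proof. by move=> B _; exists (fun=> 0); split=> [b i|i j k]; rewrite inE. Qed.

Lemma joined_extend S p (B : bool -> config K n) (P : 'I_n -> 'rV[{poly K}]_3) Q :
  (forall b i, i \in S :\ p -> val (B b i) = <[at_point b%:R (P i)]>%VS) ->
  (forall i j k, i \in S :\ p -> j \in S :\ p -> k \in S :\ p -> col A i j k ->
     det3 (P i) (P j) (P k) = 0) ->
  (forall b, val (B b p) = <[at_point b%:R Q]>%VS) ->
  (forall x y, x \in S :\ p -> y \in S :\ p -> x != y -> col A p x y ->
     det3 Q (P x) (P y) = 0) ->
  exists P' : 'I_n -> 'rV[{poly K}]_3,
    (forall b i, i \in S -> val (B b i) = <[at_point b%:R (P' i)]>%VS) /\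
    (forall i j k, i \in S -> j \in S -> k \in S -> col A i j k ->
       det3 (P' i) (P' j) (P' k) = 0).
Proof.
move=> PB Pcol QB Qcol; exists (fun i => if i == p then Q else P i).
split=> [b i iS|i j k iS jS kS].
  by have [->|ip] := eqVneq i p; [exact: QB|apply: PB; rewrite !inE ip].
have {}Qcol x y : x != p -> y != p -> x \in S -> y \in S -> col A p x y -> det3 Q (P x) (P y) = 0.
  move=> xp yp xS yS; have [->|xy] := eqVneq x y; first by rewrite det3_uvv.
  by apply: Qcol; rewrite // !inE ?xp ?yp.
have [->|ip] := eqVneq i p; have [->|jp] := eqVneq j p; have [->|kp] := eqVneq k p;
  rewrite ?det3_uuv ?det3_uvu ?det3_uvv //.
- exact: Qcol.
- by rewrite colC det3_swap12 => /Qcol -> //; rewrite oppr0.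
- by rewrite colCA colC det3_swap23 det3_swap12 => /Qcol -> //; rewrite !oppr0.
- by apply: Pcol; rewrite !inE ?ip ?jp ?kp.
Qed.

Lemma det3_col (B : config K n) (v : 'I_n -> 'rV[K]_3) i j k : realizations A B ->
  val (B i) = <[v i]>%VS -> val (B j) = <[v j]>%VS -> val (B k) = <[v k]>%VS ->
  (det3 (v i) (v j) (v k) == 0) = col A i j k.
Proof.
move=> /(same_lattice_col Ainj) [_ <-] hi hj hk.
have [a a0 ->] := vline_hcoords hi; have [b b0 ->] := vline_hcoords hj.
have [c c0 ->] := vline_hcoords hk.
by rewrite det3Z !mulf_eq0 (negPf a0) (negPf b0) (negPf c0).
Qed.

Lemma cross_realization (B : config K n) i j : realizations A B -> i != j ->
  cross (hcoords (B i)) (hcoords (B j)) != 0.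
Proof. by move=> /(same_lattice_col Ainj) [Binj _] ij; rewrite cross_hcoords // (inj_eq Binj). Qed.

Lemma crossZ (u v : 'rV[K]_3) a b : cross (a *: u) (b *: v) = (a * b) *: cross u v.
Proof. by apply: rowP3; rewrite !mxE /=; ring. Qed.

Lemma cross_vline (B : config K n) (v : 'I_n -> 'rV[K]_3) i j : realizations A B -> i != j ->
  val (B i) = <[v i]>%VS -> val (B j) = <[v j]>%VS -> cross (v i) (v j) != 0.
Proof.
move=> BA ij hi hj; have [a a0 ->] := vline_hcoords hi; have [b b0 ->] := vline_hcoords hj.
by rewrite crossZ scaler_eq0 mulf_eq0 (negPf a0) (negPf b0) /= cross_realization.
Qed.

Lemma joined_step S p : p \in S -> joined A (S :\ p) ->
  ~ rich (fun y => y \in S) (col A) p -> joined A S.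
Proof.
move=> pS J nrich B BA; have [P [PB Pcol]] := J B BA.
have ctr := col_trans Ainj.
pose on a b := [&& a \in S :\ p, b \in S :\ p, a != b & col A p a b].
have detv (b : bool) i j k : i \in S :\ p -> j \in S :\ p -> k \in S :\ p ->
    (det3 (at_point b%:R (P i)) (at_point b%:R (P j)) (at_point b%:R (P k)) == 0) = col A i j k.
  move=> iS jS kS; have hi := PB b _ iS; have hj := PB b _ jS; have hk := PB b _ kS.
  exact: (@det3_col _ (fun l => at_point b%:R (P l)) _ _ _ (BA b) hi hj hk).
have crossv (b : bool) i j : i \in S :\ p -> j \in S :\ p -> i != j ->
    cross (at_point b%:R (P i)) (at_point b%:R (P j)) != 0.
  move=> iS jS ij; have hi := PB b _ iS; have hj := PB b _ jS.
  exact: (@cross_vline _ (fun l => at_point b%:R (P l)) _ _ (BA b) ij hi hj).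
have crossP i j : i \in S :\ p -> j \in S :\ p -> i != j -> cross (P i) (P j) != 0.
  move=> iS jS ij; apply: contraNneq (crossv false _ _ iS jS ij); rewrite -at_point_cross => ->.
  by apply/eqP/rowP => k; rewrite !mxE horner0.
have hp (b : bool) i j : i \in S :\ p -> j \in S :\ p -> col A p i j ->
    det3 (at_point b%:R (P i)) (at_point b%:R (P j)) (hcoords (B b p)) = 0.
  move=> iS jS pij; apply/eqP.
  pose v k := if k == p then hcoords (B b p) else at_point b%:R (P k).
  have := @det3_col (B b) v i j p (BA b); rewrite /v.
  move: (iS) (jS); rewrite !inE => /andP[/negPf ip _] /andP[/negPf jp _].
  rewrite ip jp eqxx => -> //.
  - by rewrite colCA colC.
  - exact: PB.
  - exact: PB.
  - exact: hcoordsE.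
(* [P a] and [P b] are independent as polynomial vectors, so all points that stay on their line, [Q]
   included, lie in one plane of vectors. *)
have lineP a b Q : on a b -> det3 (P a) (P b) Q = 0 ->
    forall x y, x \in S :\ p -> y \in S :\ p -> col A p a x -> col A p a y ->
    det3 Q (P x) (P y) = 0.
  move=> /and4P[aS bS ab pab] hQ x y xS yS pax pay.
  have pa : p != a by move: aS; rewrite !inE eq_sym => /andP[].
  have abz z : col A p a z -> col A a b z.
    by move=> paz; apply: (ctr a p); rewrite // 1?eq_sym // colC.
  have /cross_neq0P [q D0] := crossP _ _ aS bS ab.
  by apply: (det3_coplanar D0) => //; apply: Pcol => //; exact: abz.
have [[a [b onab]]|none] := pselect (exists a b, on a b); last first.
  (* No line through [p] carries two further points: its coordinates are interpolated freely. *)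
  apply: (joined_extend (Q := interpv (fun b => hcoords (B b p))) PB Pcol).
    by move=> b; rewrite interpvE hcoordsE.
  by move=> x y xS yS xy pxy; case: none; exists x, y; apply/and4P.
have /and4P[aS bS ab pab] := onab.
have nap : p != a by move: aS; rewrite !inE eq_sym => /andP[].
have [[a' [b' [onab' npaa']]]|one] :=
    pselect (exists a' b', on a' b' /\ ~~ col A p a a'); last first.
  (* One such line: the coefficients of [p] with respect to [P a] and [P b] are interpolated, which
     keeps the new point on the line. *)
  have {}one x y : on x y -> col A p a x.
    by move=> oxy; apply/negPn/negP => h; apply: one; exists x, y.
  have span (e : bool) : exists st : K * K, hcoords (B e p) =
      st.1 *: at_point e%:R (P a) + st.2 *: at_point e%:R (P b).
    have [s [t ->]] := det3_span (crossv e _ _ aS bS ab) (hp e _ _ aS bS pab).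
    by exists (s, t).
  have [st stE] := choice span.
  pose Q := interp (fst \o st) *: P a + interp (snd \o st) *: P b.
  apply: (joined_extend (Q := Q) PB Pcol) => [e|x y xS yS xy pxy].
    by rewrite at_pointD !at_pointZ !interpE hcoordsE stE.
  apply: (lineP _ _ _ onab); rewrite ?det3_linear3 ?det3_uvu ?det3_uvv ?mulr0 ?addr0 //.
    by apply: one; apply/and4P; split; eassumption.
  by apply: (one y x); apply/and4P; split; rewrite // 1?eq_sym // colCA.
have /and4P[aS' bS' ab' pab'] := onab'.
have [[a3 [b3 [onab3 npa1 npa2]]]|two] :=
    pselect (exists a3 b3, [/\ on a3 b3, ~~ col A p a a3 & ~~ col A p a' a3]).
  have /and4P[aS3 bS3 ab3 pab3] := onab3.
  case: nrich; exists a, b, a', b', a3, b3; split.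
  - move: aS bS aS' bS' aS3 bS3; rewrite !inE /=.
    by do 6!case/andP => -> ->.
  - by rewrite ab ab' ab3.
  - by rewrite pab pab' pab3.
  - by rewrite npaa' npa1 npa2.
have {}two x y : on x y -> col A p a x || col A p a' x.
  move=> oxy; apply/negPn/negP; rewrite negb_or => /andP[h1 h2]; apply: two.
  by exists x, y.
have npb' : p != b' by move: bS'; rewrite !inE eq_sym => /andP[].
(* Two such lines. As [b'] is off the line [a b], the coefficient of [P a'] in [Q] below is non-zero
   at both ends, where [Q] is therefore proportional to the coordinates of [p]. *)
have nabb' : ~~ col A a b b'.
  apply: contra npaa' => abb'.
  have abp : col A a b p by rewrite colCA colC.
  have apb' := ctr _ _ _ _ ab abp abb'.
  have pb'a : col A p b' a by rewrite colCA colC.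
  by apply: (ctr p b') => //; rewrite colCA.
(* The intersection of the lines [a b] and [a' b']. *)
pose Q := det3 (P a) (P b) (P b') *: P a' + (- det3 (P a) (P b) (P a')) *: P b'.
have Q1 : det3 (P a) (P b) Q = 0 by rewrite det3_linear3; ring.
have Q2 : det3 (P a') (P b') Q = 0 by rewrite det3_linear3 det3_uvu det3_uvv; ring.
apply: (joined_extend (Q := Q) PB Pcol) => [e|x y xS yS xy pxy].
  have [s [t stE]] := det3_span (crossv e _ _ aS' bS' ab') (hp e _ _ aS' bS' pab').
  have := hp e _ _ aS bS pab; rewrite stE det3_linear3 !at_point_det3 => h.
  have d0 : (det3 (P a) (P b) (P b')).[e%:R] != 0.
    by rewrite -at_point_det3 detv.
  set u := (det3 (P a) (P b) (P b')).[e%:R] in h d0.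
  set w := (det3 (P a) (P b) (P a')).[e%:R] in h.
  have tE : t = - (s * w) / u.
    by apply: (mulIf d0); rewrite divfK //; apply/eqP; rewrite -subr_eq0 opprK addrC h.
  have s0 : s != 0.
    apply/eqP => s0; move: stE; rewrite tE s0 mul0r oppr0 mul0r !scale0r addr0 => /eqP.
    by rewrite (negPf (hcoords_neq0 _)).
  apply: (@hcoords_vline _ _ _ (s / u)); first by rewrite mulf_neq0 ?invr_eq0.
  rewrite at_pointD !at_pointZ hornerN -/u -/w stE scalerDr !scalerA divfK //; congr (_ + _ *: _).
  by rewrite tE; ring.
have oxy : on x y by apply/and4P.
have oyx : on y x by apply/and4P; split; rewrite // 1?eq_sym // colCA.
have nxp : p != x by move: xS; rewrite !inE eq_sym => /andP[].
have pyx : col A p x y := pxy.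
case/orP: (two _ _ oxy) => h.
  apply: (lineP _ _ _ onab) => //; apply: (ctr p x) => //; by rewrite colCA.
apply: (lineP _ _ _ onab') => //; apply: (ctr p x) => //; by rewrite colCA.
Qed.

(** Richness is relative to the points still left, so the removal is iterated. It may stop at a
    proper subset, whence the patterns with fewer than nine points. *)
Lemma joined_or_rich S : joined A S \/
  exists2 T : {set 'I_n}, T != finset.set0 & forall p, p \in T -> rich (fun y => y \in T) (col A) p.
Proof.
elim: {S}_.+1 {-2}S (ltnSn #|S|) => // m IH S Sm.
have [->|[p0 p0S]] := finset.set_0Vmem S; first by left; exact: joined_set0.
have [h|] := pselect (forall p, p \in S -> rich (fun y => y \in S) (col A) p).
  by right; exists S => //; apply/finset.set0Pn; exists p0.
move/existsNP => [p /not_implyP[pS nr]].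
have [|J|] := IH (S :\ p); [|by left; exact: joined_step pS J nr|by right].
by move: Sm; rewrite (cardsD1 p) pS.
Qed.
End Steps.


(** * Frames *)

Definition mx3 (R : nzRingType) (a b c : 'rV[R]_3) : 'M[R]_3 :=
  \matrix_(i, j) (nth 0 [:: a; b; c] i) 0 j.

Lemma row3_mul_mx3 (R : nzRingType) (x y z : R) (a b c : 'rV[R]_3) :
  row3 x y z *m mx3 a b c = x *: a + y *: b + z *: c.
Proof. by apply/rowP => j; rewrite !mxE sum3 !mxE. Qed.

Lemma row_mx3 (R : nzRingType) (a b c : 'rV[R]_3) :
  (row o0 (mx3 a b c) = a) * (row o1 (mx3 a b c) = b) * (row o2 (mx3 a b c) = c).
Proof. by split; first split; apply/rowP => j; rewrite !mxE. Qed.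

Section Frame.
Variable K : numFieldType.

(** The triangle 0, 1, 3 fixes a basis up to scaling its vectors; the points 2 and 4, on the sides
    01 and 03, fix the relative scales. *)
Definition standard_frame (W : nat -> 'rV[K]_3) : Prop :=
  [/\ W 0 = row3 1 0 0, W 1 = row3 0 1 0, W 2 = row3 1 1 0, W 3 = row3 0 0 1
    & W 4 = row3 1 0 1].

Definition realizes (p : pattern) (W : nat -> 'rV[K]_3) : Prop :=
  forall a b t, (a < b < t)%N -> (t < p.1)%N ->
    (det3 (W a) (W b) (W t) == 0) = coll p.2 a b t.

Lemma frame_coordinates (p : pattern) (v : nat -> 'rV[K]_3) :
  (4 < p.1)%N -> realizes p v -> 
  [&& coll p.2 0 1 2, coll p.2 0 3 4 & ~~ coll p.2 0 1 3] ->
  (forall i j, (i < j < p.1)%N -> cross (v i) (v j) != 0) ->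
  exists (G : 'M[K]_3) (W : nat -> 'rV[K]_3),
    [/\ standard_frame W, realizes p W &
      forall i, exists2 k, k != 0 & v i = k *: (W i *m G)].
Proof.
move=> p4 real /and3P[c012 c034 n013] cr.
have nc013 : det3 (v 0) (v 1) (v 3) != 0 by rewrite real // (ltn_trans _ p4).
have /eqP d012 : det3 (v 0) (v 1) (v 2) == 0 by rewrite real // (ltn_trans _ p4).
have /eqP d034 : det3 (v 0) (v 3) (v 4) == 0 by rewrite real.
have lt i : (i <= 4)%N -> (i < p.1)%N by move=> h; exact: leq_ltn_trans h p4.
have [a [b e2]] := det3_span (cr 0 1 (lt 1 isT)) d012.
have [c [d e4]] := det3_span (cr 0 3 (lt 3 isT)) d034.
have cr0 (u w : 'rV[K]_3) x : u = x *: w -> cross u w = 0 /\ cross w u = 0.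
  by move=> ->; split; apply: rowP3; rewrite !mxE /=; ring.
have a0 : a != 0.
  apply: contraNneq (cr 1 2 (lt 2 isT)) => a0; apply/eqP; apply: (proj2 (cr0 _ _ b _)).
  by rewrite e2 a0 scale0r add0r.
have b0 : b != 0.
  apply: contraNneq (cr 0 2 (lt 2 isT)) => b0; apply/eqP; apply: (proj2 (cr0 _ _ a _)).
  by rewrite e2 b0 scale0r addr0.
have c0 : c != 0.
  apply: contraNneq (cr 3 4 (lt 4 isT)) => c0; apply/eqP; apply: (proj2 (cr0 _ _ d _)).
  by rewrite e4 c0 scale0r add0r.
have d0 : d != 0.
  apply: contraNneq (cr 0 4 (lt 4 isT)) => d0; apply/eqP; apply: (proj2 (cr0 _ _ c _)).
  by rewrite e4 d0 scale0r addr0.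
(* Scaled so that [v 2 = a *: (v 0 + g1)] and [v 4 = c *: (v 0 + g2)]. *)
pose g1 := (b / a) *: v 1; pose g2 := (d / c) *: v 3.
pose G := mx3 (v 0) g1 g2.
have detG : det3 (v 0) g1 g2 != 0.
  by rewrite -[v 0]scale1r det3Z !mulf_neq0 ?invr_eq0 ?oner_eq0.
have coord (w : 'rV[K]_3) : exists x, w = x *m G.
  pose D := det3 (v 0) g1 g2.
  exists (row3 (- det3 g1 w g2 / D) (det3 (v 0) w g2 / D) (det3 (v 0) g1 w / D)).
  rewrite row3_mul_mx3; apply: (scalerI detG); rewrite four_vectors !scalerDr !scalerA.
  rewrite -/D !(mulrCA D) mulfV // !mulr1 scaleNr.
  by apply/rowP => j; rewrite !mxE; ring.
have [x hx] := choice (fun i => coord (v i)).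
(* From index 5 on, [nth] returns its default, the coordinates of [v i] in the basis [G]. *)
pose W i := nth (x i) [:: row3 1 0 0; row3 0 1 0; row3 1 1 0; row3 0 0 1; row3 1 0 1] i.
have hW i : exists2 k, k != 0 & v i = k *: (W i *m G).
  case: i => [|[|[|[|[|i]]]]]; rewrite /W /= ?row3_mul_mx3 ?scale0r ?scale1r ?add0r ?addr0.
  - by exists 1; rewrite ?oner_eq0 // scale1r.
  - exists (a / b); rewrite ?mulf_neq0 ?invr_eq0 // /g1 scalerA -mulrA mulKf //.
    by rewrite mulfV // scale1r.
  - by exists a => //; rewrite e2 scalerDr scalerA mulrCA mulfV // mulr1.
  - exists (c / d); rewrite ?mulf_neq0 ?invr_eq0 // /g2 scalerA -mulrA mulKf //.
    by rewrite mulfV // scale1r.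
  - by exists c => //; rewrite e4 scalerDr scalerA mulrCA mulfV // mulr1.
  - by exists 1; rewrite ?oner_eq0 // scale1r /W nth_default.
exists G, W; split=> // i j k ijk kp; rewrite -real //.
have [ki ki0 ->] := hW i; have [kj kj0 ->] := hW j; have [kk kk0 ->] := hW k.
rewrite det3Z det3_mul !row_mx3 !mulf_eq0.
by rewrite (negPf ki0) (negPf kj0) (negPf kk0) (negPf detG) /= orbF.
Qed.

Lemma sort3 (Q : nat -> nat -> nat -> Prop) :
  (forall a b t, Q a b t -> Q b a t) -> (forall a b t, Q a b t -> Q a t b) ->
  (forall a t, Q a a t) -> (forall a b t, (a < b < t)%N -> Q a b t) -> forall a b t, Q a b t.
Proof.
move=> s12 s23 d12 h a b t.
wlog ab : a b / (a <= b)%N.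
  by move=> H; case/orP: (leq_total a b) => [/H //|/H]; exact: s12.
wlog bt : a b t ab / (b <= t)%N.
  move=> H; have [bt|/ltnW tb] := leqP b t; first exact: H.
  have [at_|/ltnW ta] := leqP a t; first by apply/s23/H.
  by apply/s23/s12/H.
move: ab; rewrite leq_eqVlt => /predU1P[->|ab]; first exact: d12.
move: bt; rewrite leq_eqVlt => /predU1P[->|bt]; first exact: s12 (s23 _ _ _ (d12 _ _)).
by apply: h; rewrite ab.
Qed.

Lemma interpmxE (G : bool -> 'M[K]_3) (P : 'rV[{poly K}]_3) (b : bool) :
  at_point b%:R (P *m \matrix_(i, j) interp (fun b => G b i j)) = at_point b%:R P *m G b.
Proof.
by apply/rowP => j; rewrite !mxE horner_sum; apply: eq_bigr => k _; rewrite !mxE hornerM interpE.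
Qed.

(** Quantified over rings so that the same formulas serve over [K], for single realizations, and
    over [{poly K}], for the curve. *)
Definition param_family := forall R : comNzRingType, R -> R -> nat -> 'rV[R]_3.

Definition polynomial_family (C : param_family) : Prop :=
  forall x (s t : {poly K}) i, at_point x (C _ s t i) = C _ s.[x] t.[x] i.

(** At each end the realization is a member of the family transformed by a matrix. Parameters and
    matrix entries are interpolated together; collinearities survive by multiplicativity of the
    determinant. *)
Lemma joined_family (A : config K 9) (i0 : 'I_9) (p : pattern) (m : seq 'I_9) (C : param_family) :
  is_arrangement A -> p.1 = 9%N -> size m = 9%N -> uniq m ->
  (forall a b t, (a < b < t)%N -> (t < p.1)%N ->
     col A (nth i0 m a) (nth i0 m b) (nth i0 m t) = coll p.2 a b t) ->
  [&& coll p.2 0 1 2, coll p.2 0 3 4 & ~~ coll p.2 0 1 3] ->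
  polynomial_family C ->
  (forall a b t, (a < b < t)%N -> (t < 9)%N -> coll p.2 a b t ->
     forall r s, det3 (C {poly K} r s a) (C _ r s b) (C _ r s t) = 0) ->
  (forall W, standard_frame W -> realizes p W ->
     exists s t, forall i, (i < 9)%N -> exists2 k, k != 0 & W i = k *: C K s t i) ->
  joined A finset.setT.
Proof.
move=> Ainj p9 m9 um hm c0 polC vanC normal B BA.
have param b : exists GST : 'M[K]_3 * K * K, forall i, (i < 9)%N ->
    val (B b (nth i0 m i)) = <[C K GST.1.2 GST.2 i *m GST.1.1]>%VS.
  have [Binj colB] := same_lattice_col Ainj (BA b).
  pose v i := hcoords (B b (nth i0 m i)).
  have rv : realizes p v.
    by move=> i j k ijk kp; rewrite -hm // -colB.
  have cr i j : (i < j < p.1)%N -> cross (v i) (v j) != 0.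
    rewrite p9 => /andP[ij j9]; apply: cross_hcoords.
    by rewrite (inj_eq Binj) nth_uniq ?m9 ?(ltn_eqF ij) // (ltn_trans ij).
  have [|G [W [fW rW hW]]] := frame_coordinates _ rv c0 cr; first by rewrite p9.
  have [s [t hst]] := normal W fW rW.
  exists (G, s, t) => i i9 /=; have [k k0 e] := hst i i9; have [l l0] := hW i.
  rewrite e -scalemxAl scalerA; apply: hcoords_vline; by rewrite mulf_neq0.
have [GST hGST] := choice param.
pose G : 'M[{poly K}]_3 := \matrix_(i, j) interp (fun b => (GST b).1.1 i j).
pose S := interp (fun b => (GST b).1.2); pose T := interp (fun b => (GST b).2).
have im i : (index i m < 9)%N /\ nth i0 m (index i m) = i.
  have mi : i \in m.
    have := @uniq_min_size _ m (enum 'I_9) um; rewrite size_enum_ord m9 => H.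
    have [|_ ->] := H _ isT; first by move=> j _; rewrite mem_enum.
    by rewrite mem_enum.
  split; last exact: nth_index.
  by have := index_mem i m; rewrite m9 mi.
exists (fun i => C _ S T (index i m) *m G); split=> [b i _|i j k _ _ _].
  have [i9 {1}<-] := im i; rewrite (hGST b) // interpmxE polC.
  by rewrite !interpE.
have [i9 {1}<-] := im i; have [j9 {1}<-] := im j; have [k9 {1}<-] := im k.
move: (index i m) (index j m) (index k m) i9 j9 k9 => a b t.
rewrite det3_mul => a9 b9 t9 H; suff -> : det3 (C _ S T a) (C _ S T b) (C _ S T t) = 0.
  by rewrite mul0r.
move: a b t a9 b9 t9 H; apply: sort3 => [a b t H|a b t H|a t|a b t abt].
- by move=> b9 a9 t9; rewrite colC det3_swap12 => /H -> //; rewrite oppr0.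
- by move=> a9 t9 b9; rewrite colCA det3_swap23 => /H -> //; rewrite oppr0.
- by rewrite det3_uuv.
- by move=> _ _ t9; rewrite hm ?p9 // => h; apply: (vanC a b t).
Qed.
End Frame.


(** * Normal forms *)

Section NormalForms.
Variables (K : numFieldType) (W : nat -> 'rV[K]_3).
Hypothesis fW : standard_frame W.
Let x i := W i 0 o0.
Let y i := W i 0 o1.
Let z i := W i 0 o2.

(** With two points of the frame, collinearity is a linear equation in the coordinates; with one it
    is bilinear. So most incidences can be solved one after another. *)
Let f01 i : det3 (W 0) (W 1) (W i) = z i.
Proof. by case: fW => -> -> _ _ _; rewrite /det3 !mxE /= /z; ring. Qed.
Let f03 i : det3 (W 0) (W 3) (W i) = - y i.
Proof. by case: fW => -> _ _ -> _; rewrite /det3 !mxE /= /y; ring. Qed.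
Let f13 i : det3 (W 1) (W 3) (W i) = x i.
Proof. by case: fW => _ -> _ -> _; rewrite /det3 !mxE /= /x; ring. Qed.
Let f14 i : det3 (W 1) (W 4) (W i) = x i - z i.
Proof. by case: fW => _ -> _ _ ->; rewrite /det3 !mxE /= /x /z; ring. Qed.
Let f23 i : det3 (W 2) (W 3) (W i) = x i - y i.
Proof. by case: fW => _ _ -> -> _; rewrite /det3 !mxE /= /x /y; ring. Qed.
Let f24 i : det3 (W 2) (W 4) (W i) = x i - y i - z i.
Proof. by case: fW => _ _ -> _ ->; rewrite /det3 !mxE /= /x /y /z; ring. Qed.
Let f0 i j : det3 (W 0) (W i) (W j) = y i * z j - z i * y j.
Proof. by case: fW => -> _ _ _ _; rewrite /det3 !mxE /= /y /z; ring. Qed.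
Let f1 i j : det3 (W 1) (W i) (W j) = z i * x j - x i * z j.
Proof. by case: fW => _ -> _ _ _; rewrite /det3 !mxE /= /x /z; ring. Qed.
Let f2 i j : det3 (W 2) (W i) (W j) = y i * z j - z i * y j - (x i * z j - z i * x j).
Proof. by case: fW => _ _ -> _ _; rewrite /det3 !mxE /= /x /y /z; ring. Qed.
Let f3 i j : det3 (W 3) (W i) (W j) = x i * y j - y i * x j.
Proof. by case: fW => _ _ _ -> _; rewrite /det3 !mxE /= /x /y; ring. Qed.
Let f4 i j : det3 (W 4) (W i) (W j) = y i * z j - z i * y j + (x i * y j - y i * x j).
Proof. by case: fW => _ _ _ _ ->; rewrite /det3 !mxE /= /x /y /z; ring. Qed.

Let scaled i k a b c : x i = k * a -> y i = k * b -> z i = k * c -> W i = k *: row3 a b c.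
Proof. by move=> h1 h2 h3; apply: rowP3; rewrite !mxE. Qed.

Let unit_scale C : (forall i, (5 <= i < 9)%N -> exists2 k, k != 0 & W i = k *: C i) ->
  standard_frame C -> forall i, (i < 9)%N -> exists2 k, k != 0 & W i = k *: C i.
Proof.
move=> h [c0 c1 c2 c3 c4] i i9; case: (leqP 5 i) => [i5|]; first by apply: h; rewrite i5.
case: fW => w0 w1 w2 w3 w4; case: i {i9} => [|[|[|[|[|//]]]]] _;
  by exists 1; rewrite ?oner_eq0 // scale1r ?c0 ?c1 ?c2 ?c3 ?c4.
Qed.

(** The incidences force [2 * (y 5 * x 6) = 0] with both coordinates non-zero, which only
    characteristic two allows. *)
Lemma fano_unrealizable : realizes fano W -> False.
Proof.
move=> rel.
have x5 : x 5 = 0 by apply/eqP; rewrite -f13 rel.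
have y5 : y 5 != 0 by rewrite -oppr_eq0 -f03 rel.
have x6 : x 6 != 0 by rewrite -f13 rel.
have e056 : y 5 * z 6 - z 5 * y 6 = 0 by apply/eqP; rewrite -f0 rel.
have e146 : z 6 = x 6 by apply/esym/subr0_eq/eqP; rewrite -f14 rel.
have e236 : y 6 = x 6 by apply/esym/subr0_eq/eqP; rewrite -f23 rel.
have e245 : x 5 - y 5 - z 5 = 0 by apply/eqP; rewrite -f24 rel.
have z5 : z 5 = - y 5 by apply/esym/subr0_eq; rewrite -e245 x5; ring.
have : 2 * (y 5 * x 6) = 0 by rewrite -e056 e146 e236 z5; ring.
by apply/eqP; rewrite !mulf_neq0 // pnatr_eq0.
Qed.

Lemma ten_char2_unrealizable : realizes ten_char2 W -> False.
Proof.
move=> rel.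
have x5 : x 5 = 0 by apply/eqP; rewrite -f13 rel.
have y5 : y 5 != 0 by rewrite -oppr_eq0 -f03 rel.
have x6 : x 6 != 0 by rewrite -f13 rel.
have x7 : x 7 != 0 by rewrite -f13 rel.
have x8 : x 8 != 0 by rewrite -f13 rel.
have e714 : z 7 = x 7 by apply/esym/subr0_eq/eqP; rewrite -f14 rel.
have e283 : y 8 = x 8 by apply/esym/subr0_eq/eqP; rewrite -f23 rel.
have e564 : y 5 * z 6 - z 5 * y 6 + (x 5 * y 6 - y 5 * x 6) = 0 by apply/eqP; rewrite -f4 rel.
have e736 : x 6 * y 7 - y 6 * x 7 = 0 by apply/eqP; rewrite -f3 rel.
have e580 : y 5 * z 8 - z 5 * y 8 = 0 by apply/eqP; rewrite -f0 rel.
have e816 : z 6 * x 8 - x 6 * z 8 = 0 by apply/eqP; rewrite -f1 rel.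
have e572 : y 5 * z 7 - z 5 * y 7 - (x 5 * z 7 - z 5 * x 7) = 0 by apply/eqP; rewrite -f2 rel.
have : 2 * (y 5 * x 6 * x 7 * x 8) = 0.
  (* A certificate: twice a product of non-zero coordinates as a combination of the five bilinear
     incidence equations. *)
  have -> : 2 * (y 5 * x 6 * x 7 * x 8) =
      x 6 * x 8 * (y 5 * z 7 - z 5 * y 7 - (x 5 * z 7 - z 5 * x 7))
      - x 7 * x 8 * (y 5 * z 6 - z 5 * y 6 + (x 5 * y 6 - y 5 * x 6))
      + z 5 * x 8 * (x 6 * y 7 - y 6 * x 7)
      + x 7 * y 5 * (z 6 * x 8 - x 6 * z 8) + x 7 * x 6 * (y 5 * z 8 - z 5 * y 8).
    by rewrite x5 e714 e283; ring.
  by rewrite e564 e736 e580 e816 e572; ring.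
by apply/eqP; rewrite !mulf_neq0 // pnatr_eq0.
Qed.

Definition pappus_family : param_family := fun R s t i =>
  nth (row3 1 1 t) [:: row3 1 0 0; row3 0 1 0; row3 1 1 0; row3 0 0 1; row3 1 0 1;
    row3 (s - t * (s - 1)) s t; row3 1 s t; row3 1 s 1; row3 1 1 t] i.

Lemma pappus_normal : realizes pappus W ->
  exists s t, forall i, (i < 9)%N -> exists2 k, k != 0 & W i = k *: pappus_family s t i.
Proof.
move=> rel.
have z5 : z 5 != 0 by rewrite -f01 rel.
have x6 : x 6 != 0 by rewrite -f13 rel.
have z6 : z 6 != 0 by rewrite -f01 rel.
have z7 : z 7 != 0 by rewrite -f01 rel.
have x8 : x 8 != 0 by rewrite -f13 rel.
have e147 : x 7 = z 7 by apply/subr0_eq/eqP; rewrite -f14 rel.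
have e238 : y 8 = x 8 by apply/esym/subr0_eq/eqP; rewrite -f23 rel.
have e367 : x 6 * y 7 - y 6 * x 7 = 0 by apply/eqP; rewrite -f3 rel.
have e168 : z 6 * x 8 - x 6 * z 8 = 0 by apply/eqP; rewrite -f1 rel.
have e056 : y 5 * z 6 - z 5 * y 6 = 0 by apply/eqP; rewrite -f0 rel.
have e257 : y 5 * z 7 - z 5 * y 7 - (x 5 * z 7 - z 5 * x 7) = 0 by apply/eqP; rewrite -f2 rel.
have y7 : y 7 = y 6 / x 6 * z 7.
  apply: (mulfI x6); apply: subr0_eq; rewrite -e367 e147; by field.
have z8 : z 8 = z 6 / x 6 * x 8.
  apply: (mulfI x6); apply/esym/subr0_eq; rewrite -e168; by field.
have y5 : y 5 = z 5 * y 6 / z 6.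
  apply: (mulIf z6); apply: subr0_eq; rewrite -e056; by field.
have x5 : x 5 = y 5 + z 5 - z 5 * y 6 / x 6.
  apply: (mulIf z7); apply/esym/subr0_eq; rewrite -e257 y7 e147; by field.
exists (y 6 / x 6), (z 6 / x 6); apply: unit_scale => [i|//].
case: i => [|[|[|[|[|[|[|[|[|//]]]]]]]]] // _; rewrite /pappus_family /=.
- exists (z 5 * x 6 / z 6); rewrite ?mulf_neq0 ?invr_eq0 //; 
  by apply: scaled; rewrite ?x5 ?y5; field; rewrite ?x6 ?z6.
- by exists (x 6) => //; apply: scaled; field.
- by exists (z 7) => //; apply: scaled; rewrite ?y7 ?e147; field.
- by exists (x 8) => //; apply: scaled; rewrite ?z8 ?e238; field.
Qed.

(* With point 5 at [1 : 1 : d] and point 6 at [1 : s : 1], the incidences amount to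
   [(s ^+ 2 - s + 1) * d = s]. *)
Definition nine3_2_family : param_family := fun R s t i =>
  let n := s ^+ 2 - s + 1 in
  nth (row3 1 n s) [:: row3 1 0 0; row3 0 1 0; row3 1 1 0; row3 0 0 1; row3 1 0 1;
    row3 n n s; row3 1 s 1; row3 0 n (s - 1); row3 1 n s] i.

Lemma nine3_2_normal : realizes nine3_2 W ->
  exists s t, forall i, (i < 9)%N -> exists2 k, k != 0 & W i = k *: nine3_2_family s t i.
Proof.
move=> rel.
have x5 : x 5 != 0 by rewrite -f13 rel.
have z6 : z 6 != 0 by rewrite -f01 rel.
have y6 : y 6 != 0 by rewrite -oppr_eq0 -f03 rel.
have y7 : y 7 != 0 by rewrite -oppr_eq0 -f03 rel.
have y8 : y 8 != 0 by rewrite -oppr_eq0 -f03 rel.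
have e146 : x 6 = z 6 by apply/subr0_eq/eqP; rewrite -f14 rel.
have e235 : y 5 = x 5 by apply/esym/subr0_eq/eqP; rewrite -f23 rel.
have x7 : x 7 = 0 by apply/eqP; rewrite -f13 rel.
have e058 : y 5 * z 8 - z 5 * y 8 = 0 by apply/eqP; rewrite -f0 rel.
have e268 : y 6 * z 8 - z 6 * y 8 - (x 6 * z 8 - z 6 * x 8) = 0 by apply/eqP; rewrite -f2 rel.
have e478 : y 7 * z 8 - z 7 * y 8 + (x 7 * y 8 - y 7 * x 8) = 0 by apply/eqP; rewrite -f4 rel.
have e567 : det3 (W 5) (W 6) (W 7) = 0 by apply/eqP; rewrite rel.
rewrite /det3 -!/(x _) -!/(y _) -!/(z _) in e567.
pose s := y 6 / z 6; pose d := z 5 / x 5.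
have y6E : y 6 = s * z 6 by rewrite divfK.
have z5E : z 5 = d * x 5 by rewrite divfK.
have s0 : s != 0 by rewrite mulf_neq0 ?invr_eq0.
have z8 : z 8 = d * y 8.
  by apply: (mulfI x5); apply: subr0_eq; rewrite -e058 e235 z5E; ring.
have x8 : x 8 = y 8 * (1 + d - s * d).
  by apply: (mulfI z6); apply: subr0_eq; rewrite -e268 z8 y6E e146; ring.
have z7 : z 7 = y 7 * (s * d - 1).
  by apply: (mulIf y8); apply/esym/subr0_eq; rewrite -e478 z8 x8 x7; ring.
have sd : (s ^+ 2 - s + 1) * d = s.
  apply: (mulfI x5); apply: (mulfI z6); apply: (mulfI y7); apply: subr0_eq.
  by rewrite -e567 x7 z7 y6E z5E e146 e235; ring.
have n0 : s ^+ 2 - s + 1 != 0 by apply: contraNneq s0 => n0; rewrite -sd n0 mul0r.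
have dE : d = s / (s ^+ 2 - s + 1) by apply: (mulfI n0); rewrite sd [RHS]mulrC divfK.
exists s, 0; apply: unit_scale => [i|//].
case: i => [|[|[|[|[|[|[|[|[|//]]]]]]]]] // _; rewrite /nine3_2_family /=.
- exists (x 5 / (s ^+ 2 - s + 1)); rewrite ?mulf_neq0 ?invr_eq0 //.
  by apply: scaled; rewrite ?e235 ?z5E ?dE; field.
- by exists (z 6) => //; apply: scaled; rewrite ?y6E ?e146; ring.
- exists (y 7 / (s ^+ 2 - s + 1)); rewrite ?mulf_neq0 ?invr_eq0 //.
  by apply: scaled; rewrite ?x7 ?z7 ?dE; field.
- exists (y 8 / (s ^+ 2 - s + 1)); rewrite ?mulf_neq0 ?invr_eq0 //.
  by apply: scaled; rewrite ?x8 ?z8 ?dE; field.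
Qed.

(* With point 5 at [0 : 1 : s] and point 6 at [1 : d : 1 + s d], the incidences amount to
   [(1 + s d) (1 + s) (1 + d) = 0], whose first two factors vanish only in degenerate cases. *)
Definition nine3_3_family : param_family := fun R s t i =>
  nth (row3 (- s) (- 1) (1 - s)) [:: row3 1 0 0; row3 0 1 0; row3 1 1 0; row3 0 0 1; row3 1 0 1;
    row3 0 1 s; row3 1 (- 1) (1 - s); row3 s 1 (s * (1 - s)); row3 (- s) (- 1) (1 - s)] i.

Lemma nine3_3_normal : realizes nine3_3 W ->
  exists s t, forall i, (i < 9)%N -> exists2 k, k != 0 & W i = k *: nine3_3_family s t i.
Proof.
move=> rel.
have y5 : y 5 != 0 by rewrite -oppr_eq0 -f03 rel.
have x6 : x 6 != 0 by rewrite -f13 rel.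
have z6 : z 6 != 0 by rewrite -f01 rel.
have x7 : x 7 != 0 by rewrite -f13 rel.
have y7 : y 7 != 0 by rewrite -oppr_eq0 -f03 rel.
have y8 : y 8 != 0 by rewrite -oppr_eq0 -f03 rel.
have n245 : x 5 - y 5 - z 5 != 0 by rewrite -f24 rel.
have x5 : x 5 = 0 by apply/eqP; rewrite -f13 rel.
have e248 : x 8 - y 8 - z 8 = 0 by apply/eqP; rewrite -f24 rel.
have e456 : y 5 * z 6 - z 5 * y 6 + (x 5 * y 6 - y 5 * x 6) = 0 by apply/eqP; rewrite -f4 rel.
have e068 : y 6 * z 8 - z 6 * y 8 = 0 by apply/eqP; rewrite -f0 rel.
have e257 : y 5 * z 7 - z 5 * y 7 - (x 5 * z 7 - z 5 * x 7) = 0 by apply/eqP; rewrite -f2 rel.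
have e167 : z 6 * x 7 - x 6 * z 7 = 0 by apply/eqP; rewrite -f1 rel.
have e378 : x 7 * y 8 - y 7 * x 8 = 0 by apply/eqP; rewrite -f3 rel.
pose s := z 5 / y 5; pose d := y 6 / x 6.
have z5E : z 5 = s * y 5 by rewrite divfK.
have y6E : y 6 = d * x 6 by rewrite divfK.
have z6E : z 6 = x 6 * (1 + s * d).
  by apply: (mulfI y5); apply: subr0_eq; rewrite -e456 x5 z5E y6E; ring.
have z7 : z 7 = (1 + s * d) * x 7.
  by apply: (mulfI x6); apply/esym/subr0_eq; rewrite -e167 z6E; ring.
have sy7 : s * y 7 = (1 + s * d + s) * x 7.
  by apply: (mulfI y5); apply/esym/subr0_eq; rewrite -e257 z7 z5E x5; ring.
have dz8 : d * z 8 = (1 + s * d) * y 8.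
  by apply: (mulfI x6); apply: subr0_eq; rewrite -e068 z6E y6E; ring.
have x8 : x 8 = y 8 + z 8 by apply: subr0_eq; rewrite -e248; ring.
have d1 : d = - 1.
  have : (1 + s * d) * (1 + s) * (1 + d) * (x 7 * y 8) = 0.
    have -> : (1 + s * d) * (1 + s) * (1 + d) * (x 7 * y 8) =
      (1 + s * d + s) * x 7 * (d * y 8 + (1 + s * d) * y 8) - s * d * (x 7 * y 8) by ring.
    rewrite -dz8 -mulrDr -x8 -sy7.
    by rewrite -[RHS](mulr0 (- (s * d))) -e378; ring.
  move/eqP; rewrite !mulf_eq0 (negPf x7) (negPf y8) !orbF => /orP[/orP[]|] /eqP h.
  - by move: z6; rewrite z6E h mulr0 eqxx.
  - have s1 : s = - 1 by apply: subr0_eq; rewrite opprK addrC.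
    by move: n245; rewrite x5 z5E s1 mulN1r opprK sub0r addNr eqxx.
  - by apply: subr0_eq; rewrite opprK addrC.
have x7E : x 7 = s * y 7 by rewrite sy7 d1; ring.
have z8E : z 8 = (s - 1) * y 8.
  by move: dz8; rewrite d1 mulN1r => h; apply: oppr_inj; rewrite h; ring.
exists s, 0; apply: unit_scale => [i|//].
case: i => [|[|[|[|[|[|[|[|[|//]]]]]]]]] // _; rewrite /nine3_3_family /=.
- by exists (y 5) => //; apply: scaled; rewrite ?x5 ?z5E; ring.
- by exists (x 6) => //; apply: scaled; rewrite ?z6E ?y6E ?d1; ring.
- by exists (y 7) => //; apply: scaled; rewrite ?z7 ?x7E ?d1; ring.
- exists (- y 8); first by rewrite oppr_eq0.
  by apply: scaled; rewrite ?x8 ?z8E; ring.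
Qed.

(* With point 5 at [0 : 1 : a] and point 8 at [s : 1 : s], the incidences amount to
   [(1 - s) * a = s]. *)
Definition ten_linear_family : param_family := fun R s t i =>
  nth (row3 s 1 s) [:: row3 1 0 0; row3 0 1 0; row3 1 1 0; row3 0 0 1; row3 1 0 1;
    row3 0 (1 - s) s; row3 (s * (1 - s)) (1 - s) s; row3 (1 - s) (1 - s) 1; row3 s 1 s] i.

Lemma ten_linear_normal : realizes ten_linear W ->
  exists s t, forall i, (i < 9)%N -> exists2 k, k != 0 & W i = k *: ten_linear_family s t i.
Proof.
move=> rel.
have y5 : y 5 != 0 by rewrite -oppr_eq0 -f03 rel.
have y6 : y 6 != 0 by rewrite -oppr_eq0 -f03 rel.
have x7 : x 7 != 0 by rewrite -f13 rel.
have y8 : y 8 != 0 by rewrite -oppr_eq0 -f03 rel.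
have x5 : x 5 = 0 by apply/eqP; rewrite -f13 rel.
have e148 : z 8 = x 8 by apply/esym/subr0_eq/eqP; rewrite -f14 rel.
have e237 : y 7 = x 7 by apply/esym/subr0_eq/eqP; rewrite -f23 rel.
have e056 : y 5 * z 6 - z 5 * y 6 = 0 by apply/eqP; rewrite -f0 rel.
have e368 : x 6 * y 8 - y 6 * x 8 = 0 by apply/eqP; rewrite -f3 rel.
have e167 : z 6 * x 7 - x 6 * z 7 = 0 by apply/eqP; rewrite -f1 rel.
have e457 : y 5 * z 7 - z 5 * y 7 + (x 5 * y 7 - y 5 * x 7) = 0 by apply/eqP; rewrite -f4 rel.
pose s := x 6 / y 6; pose a := z 5 / y 5.
have x6 : x 6 = s * y 6 by rewrite divfK.
have z5 : z 5 = a * y 5 by rewrite divfK.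
have z6 : z 6 = a * y 6 by apply: (mulfI y5); apply: subr0_eq; rewrite -e056 z5; ring.
have x8 : x 8 = s * y 8.
  by apply: (mulfI y6); apply/esym/subr0_eq; rewrite -e368 x6; ring.
have z7 : z 7 = (a + 1) * x 7.
  by apply: (mulfI y5); apply: subr0_eq; rewrite -e457 x5 z5 e237; ring.
have sa : (1 - s) * a = s.
  by apply: (mulfI x7); apply: (mulfI y6); apply: subr0_eq; rewrite -e167 x6 z6 z7; ring.
have s1 : 1 - s != 0.
  apply/eqP => h; move: sa; rewrite h mul0r => s0; move/eqP: h.
  by rewrite -s0 subr0 oner_eq0.
have aE : a = s / (1 - s) by apply: (mulfI s1); rewrite sa [RHS]mulrC divfK.
exists s, 0; apply: unit_scale => [i|//].
case: i => [|[|[|[|[|[|[|[|[|//]]]]]]]]] // _; rewrite /ten_linear_family /=.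
- exists (y 5 / (1 - s)); rewrite ?mulf_neq0 ?invr_eq0 //.
  by apply: scaled; rewrite ?x5 ?z5 ?aE; field.
- exists (y 6 / (1 - s)); rewrite ?mulf_neq0 ?invr_eq0 //.
  by apply: scaled; rewrite ?x6 ?z6 ?aE; field.
- exists (x 7 / (1 - s)); rewrite ?mulf_neq0 ?invr_eq0 //.
  by apply: scaled; rewrite ?e237 ?z7 ?aE; field.
- by exists (y 8) => //; apply: scaled; rewrite ?e148 ?x8; ring.
Qed.
End NormalForms.

Section Joined.
Variable K : numFieldType.

Lemma polynomial_row3 x (a b c : {poly K}) :
  at_point x (row3 a b c) = row3 a.[x] b.[x] c.[x].
Proof. by apply: rowP3; rewrite !mxE. Qed.

Lemma pappus_polynomial : polynomial_family K pappus_family.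
Proof.
move=> x s t i; rewrite /pappus_family.
case: i => [|[|[|[|[|[|[|[|[|i]]]]]]]]]; rewrite /= ?nth_nil polynomial_row3;
  by rewrite !(hornerE, hornerN).
Qed.

Lemma nine3_2_polynomial : polynomial_family K nine3_2_family.
Proof.
move=> x s t i; rewrite /nine3_2_family.
case: i => [|[|[|[|[|[|[|[|[|i]]]]]]]]]; rewrite /= ?nth_nil polynomial_row3;
  by rewrite !(hornerE, hornerN, horner_exp).
Qed.

Lemma nine3_3_polynomial : polynomial_family K nine3_3_family.
Proof.
move=> x s t i; rewrite /nine3_3_family.
case: i => [|[|[|[|[|[|[|[|[|i]]]]]]]]]; rewrite /= ?nth_nil polynomial_row3;
  by rewrite !(hornerE, hornerN).
Qed.

Lemma ten_linear_polynomial : polynomial_family K ten_linear_family.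
Proof.
move=> x s t i; rewrite /ten_linear_family.
case: i => [|[|[|[|[|[|[|[|[|i]]]]]]]]]; rewrite /= ?nth_nil polynomial_row3;
  by rewrite !(hornerE, hornerN).
Qed.
End Joined.

Definition collinear_triples (pl : seq (seq nat)) : seq (nat * nat * nat) :=
  [seq u <- [seq (ab, t) | t <- iota 0 9, ab <- [seq (a, b) | b <- iota 0 t, a <- iota 0 b]]
  | coll pl u.1.1 u.1.2 u.2].

Lemma mem_collinear_triples pl a b t : (a < b < t)%N -> (t < 9)%N -> coll pl a b t ->
  (a, b, t) \in collinear_triples pl.
Proof.
move=> /andP[ab bt] t9 h; rewrite mem_filter h andTb.
apply/allpairsPdep; exists t, (a, b); split=> //; first by rewrite mem_iota.
by apply/allpairsPdep; exists b, a; rewrite !mem_iota.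
Qed.

Definition vanishing (p : pattern) (C : param_family) : Prop :=
  forall a b t, (a < b < t)%N -> (t < 9)%N -> coll p.2 a b t ->
     forall (R : comNzRingType) (r s : R), det3 (C _ r s a) (C _ r s b) (C _ r s t) = 0.

Lemma vanishing_all (p : pattern) (C : param_family) :
  (forall (R : comNzRingType) (r s : R),
    all (fun u => det3 (C _ r s u.1.1) (C _ r s u.1.2) (C _ r s u.2) == 0)
     (collinear_triples p.2)) -> vanishing p C.
Proof.
move=> h a b t abt t9 /(mem_collinear_triples abt t9) hc R r s.
by have /allP/(_ _ hc)/eqP := h R r s.
Qed.

Lemma pappus_vanishing : vanishing pappus pappus_family.
Proof.
(* Only the list of triples is computed; the determinants stay symbolic for [ring]. *)
apply: vanishing_all => R r s; set u := collinear_triples _; vm_compute in u; rewrite {}/u /=.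
by repeat (apply/andP; split; [apply/eqP; rewrite /det3 !mxE /=; ring|]).
Qed.

Lemma nine3_2_vanishing : vanishing nine3_2 nine3_2_family.
Proof.
apply: vanishing_all => R r s; set u := collinear_triples _; vm_compute in u; rewrite {}/u /=.
by repeat (apply/andP; split; [apply/eqP; rewrite /det3 !mxE /=; ring|]).
Qed.

Lemma nine3_3_vanishing : vanishing nine3_3 nine3_3_family.
Proof.
apply: vanishing_all => R r s; set u := collinear_triples _; vm_compute in u; rewrite {}/u /=.
by repeat (apply/andP; split; [apply/eqP; rewrite /det3 !mxE /=; ring|]).
Qed.

Lemma ten_linear_vanishing : vanishing ten_linear ten_linear_family.
Proof.
apply: vanishing_all => R r s; set u := collinear_triples _; vm_compute in u; rewrite {}/u /=.
by repeat (apply/andP; split; [apply/eqP; rewrite /det3 !mxE /=; ring|]).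
Qed.

Section Patterns.
Variables (K : numFieldType) (n : nat) (A : config K n) (i0 : 'I_n).
Hypothesis Ainj : is_arrangement A.

Definition matches (p : pattern) (m : seq 'I_n) : Prop :=
  [/\ size m = p.1, uniq m & forall a b t, (a < b < t)%N -> (t < p.1)%N ->
     col A (nth i0 m a) (nth i0 m b) (nth i0 m t) = coll p.2 a b t].

Lemma matches_frame p m : matches p m -> (4 < p.1)%N ->
  [&& coll p.2 0 1 2, coll p.2 0 3 4 & ~~ coll p.2 0 1 3] ->
  exists2 W : nat -> 'rV[K]_3, standard_frame W & realizes p W.
Proof.
move=> [sm um hm] p4 c0; pose v i := hcoords (A (nth i0 m i)).
have cr i j : (i < j < p.1)%N -> cross (v i) (v j) != 0.
  move=> /andP[ij jp]; apply: cross_hcoords.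
  by rewrite (inj_eq Ainj) nth_uniq ?sm ?(ltn_eqF ij) // (ltn_trans ij).
have [//|G [W [fW rW _]]] := @frame_coordinates _ p v p4 _ c0 cr.
by exists W.
Qed.

Lemma not_matches_fano m : ~ matches fano m.
Proof. by case/matches_frame => // W fW; exact: fano_unrealizable. Qed.

Lemma not_matches_ten_char2 m : ~ matches ten_char2 m.
Proof. by case/matches_frame => // W fW; exact: ten_char2_unrealizable. Qed.
End Patterns.

Lemma matches_joined (K : numFieldType) (A : config K 9) (i0 : 'I_9) p m :
  is_arrangement A -> p \in [:: pappus; nine3_2; nine3_3; ten_linear] ->
  matches A i0 p m -> joined A finset.setT.
Proof.
move=> Ainj; rewrite !inE => /or4P[] /eqP -> [sm um hm].
- apply: (@joined_family _ A i0 pappus m pappus_family Ainj erefl sm um hm) => //.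
    exact: pappus_polynomial.
    by move=> a b t abt t9 h r s; exact: pappus_vanishing.
  exact: pappus_normal.
- apply: (@joined_family _ A i0 nine3_2 m nine3_2_family Ainj erefl sm um hm) => //.
    exact: nine3_2_polynomial.
    by move=> a b t abt t9 h r s; exact: nine3_2_vanishing.
  exact: nine3_2_normal.
- apply: (@joined_family _ A i0 nine3_3 m nine3_3_family Ainj erefl sm um hm) => //.
    exact: nine3_3_polynomial.
    by move=> a b t abt t9 h r s; exact: nine3_3_vanishing.
  exact: nine3_3_normal.
- apply: (@joined_family _ A i0 ten_linear m ten_linear_family Ainj erefl sm um hm) => //.
    exact: ten_linear_polynomial.
    by move=> a b t abt t9 h r s; exact: ten_linear_vanishing.
  exact: ten_linear_normal.
Qed.


(** * MacLane arrangements *)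

Lemma coll_C ls a b t : coll ls a b t = coll ls b a t.
Proof. by rewrite !collE; apply: eq_has => l; rewrite andbCA. Qed.

Lemma coll_CA ls a b t : coll ls a b t = coll ls a t b.
Proof. by rewrite !collE; apply: eq_has => l; rewrite [X in _ && X]andbC. Qed.

Section Sub.
Variables (K : numFieldType) (n : nat) (A : config K n) (i0 : 'I_n).

Lemma matches_col p m : matches A i0 p m -> forall a b t,
  (a < p.1)%N -> (b < p.1)%N -> (t < p.1)%N -> a != b -> a != t -> b != t ->
  col A (nth i0 m a) (nth i0 m b) (nth i0 m t) = coll p.2 a b t.
Proof.
move=> [_ _ hm]; apply: sort3 => [a b t H|a b t H|a t|a b t abt].
- by move=> *; rewrite colC coll_C H // eq_sym.
- by move=> *; rewrite colCA coll_CA H // eq_sym.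
- by rewrite eqxx.
- by move=> *; exact: hm.
Qed.

(** Non-collinear triples have to match as well, since further triple points would spoil a MacLane
    arrangement. With [idx] of full length this is a renumbering. *)
Definition subpattern (q p : pattern) (idx : seq nat) : bool :=
  [&& size idx == q.1, uniq idx, all (gtn p.1) idx &
    all (fun t => all (fun b => all (fun a =>
      coll q.2 a b t == coll p.2 (nth 0 idx a) (nth 0 idx b) (nth 0 idx t))%N
      (iota 0 b)) (iota 0 t)) (iota 0 q.1)].

Lemma matches_sub q p idx m : subpattern q p idx -> matches A i0 p m ->
  matches A i0 q (map (nth i0 m) idx).
Proof.
move=> /and4P[/eqP si ui /allP ip /allP hi] Hm; have [sm um _] := Hm.
split; first by rewrite size_map.
  rewrite map_inj_in_uniq // => i j /ip ik /ip jk /eqP; rewrite nth_uniq ?sm //.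
  by move/eqP.
move=> a b t /andP[ab bt] tp; have bp := ltn_trans bt tp; have ap := ltn_trans ab bp.
rewrite !(nth_map 0%N) ?si //.
have iotaP x y : (x < y)%N -> x \in iota 0 y by rewrite mem_iota.
have /allP/(_ _ (iotaP _ _ bt))/allP/(_ _ (iotaP _ _ ab))/eqP -> := hi _ (iotaP _ _ tp).
by apply: matches_col; rewrite ?nth_uniq ?si //;
  rewrite ?(ltn_eqF ab) ?(ltn_eqF bt) ?(ltn_eqF (ltn_trans ab bt)) //;
  apply: ip; rewrite mem_nth // si.
Qed.
End Sub.

(** The translates of 0, 1, 3 modulo 8 are the cyclic form of the Moebius-Kantor configuration.
    Dually, a block lists the lines through one triple point. *)
Definition block (b : nat) : seq nat := [:: b; (b + 1) %% 8; (b + 3) %% 8]%N.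

(* The blocks through [i] are those of index [i], [i - 1] and [i - 3]. *)
Definition block_through (i k : nat) : nat := ((i + nth 0 [:: 0; 7; 5] k) %% 8)%N.

Section MacLane.
Variables (K : numFieldType) (C : config K 8).
Hypothesis Cinj : is_arrangement C.
Hypothesis colC8 : forall i j k : 'I_8, i != j -> i != k -> j != k ->
  col C i j k = coll maclane.2 i j k.

Definition meeting_point (i j : 'I_8) : proj_plane K :=
  point_of (cross (hcoords (C i)) (hcoords (C j))).

Lemma on_lineE p (i : 'I_8) : on_line p (C i) = (hcoords p *m (hcoords (C i))^T == 0).
Proof. by rewrite /on_line hcoordsE -memvE mem_line. Qed.

Lemma on_line_vline p v (i : 'I_8) : val p = <[v]>%VS ->
  on_line p (C i) = (v *m (hcoords (C i))^T == 0).
Proof. by move=> e; rewrite /on_line e -memvE mem_line. Qed.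

Lemma cross8 (i j : 'I_8) : i != j -> cross (hcoords (C i)) (hcoords (C j)) != 0.
Proof. by move=> ij; rewrite cross_hcoords // (inj_eq Cinj). Qed.

Lemma on_meet i j k : i != j -> on_line (meeting_point i j) (C k) = col C i j k.
Proof.
move=> ij; rewrite (on_line_vline _ (val_point_of (cross8 ij))) /col -cross_dot.
apply/eqP/eqP => [->|h]; first by rewrite mxE.
by apply/matrixP => x y; rewrite !ord1 h mxE.
Qed.

Lemma meetP i j p : i != j -> on_line p (C i) -> on_line p (C j) -> p = meeting_point i j.
Proof.
move=> ij; rewrite !on_lineE => /eqP pi /eqP pj.
have [k kE] := orth_cross (cross8 ij) pi pj.
have k0 : k != 0 by apply: contraNneq (hcoords_neq0 p) => k0; rewrite kE k0 scale0r.
apply: val_inj => /=; rewrite val_point_of ?cross8 //.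
exact: hcoords_vline k0 kE.
Qed.

(** The differences within 0, 1, 3 are distinct modulo 8, so two consecutive lines determine their
    block. *)
Definition tripoint (b : nat) : proj_plane K := meeting_point (inord b) (inord ((b + 1) %% 8)).

Lemma on_tripoint b (k : 'I_8) : (b < 8)%N -> on_line (tripoint b) (C k) = ((k : nat) \in block b).
Proof.
move=> b8; have b18 : ((b + 1) %% 8 < 8)%N by rewrite ltn_mod.
have bb : (inord b : 'I_8) != inord ((b + 1) %% 8).
  by rewrite -val_eqE /= !inordK //; lia.
rewrite on_meet //.
have [<-|kb] := eqVneq (inord b) k; first by rewrite col_iji !inE inordK ?eqxx.
have [<-|kb1] := eqVneq (inord ((b + 1) %% 8)) k.
  by rewrite col_ijj !inE inordK ?eqxx ?orbT.
rewrite colC8 // !inordK //; move: kb kb1; rewrite -!val_eqE /= !inordK // => kb kb1.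
have H : all (fun b => all (fun k => (b != k) ==> ((b + 1) %% 8 != k)%N ==>
    (coll maclane.2 b ((b + 1) %% 8) k == (k \in block b))) (iota 0 8)) (iota 0 8) by vm_compute.
have := allP (allP H b _) k; rewrite !mem_iota ltn_ord b8 => /(_ isT isT).
by rewrite kb kb1 => /eqP.
Qed.

Lemma tripoint_inj b b' : (b < 8)%N -> (b' < 8)%N -> tripoint b = tripoint b' -> b = b'.
Proof.
move=> b8 b8' e.
have H : all (fun b => all (fun b' => all (fun k => (k \in block b) == (k \in block b'))
   (iota 0 8) ==> (b == b')) (iota 0 8)) (iota 0 8) by vm_compute.
have := allP (allP H b _) b'; rewrite !mem_iota b8 b8' => /(_ isT isT) /implyP h.
apply/eqP/h/allP => k; rewrite mem_iota => k8.
have := on_tripoint (Ordinal k8) b8; have := on_tripoint (Ordinal k8) b8'.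
by rewrite e => -> ->.
Qed.

Lemma multiplicity_tripoint b : (b < 8)%N -> multiplicity C (tripoint b) = 3%N.
Proof.
move=> b8; rewrite /multiplicity.
have b18 : ((b + 1) %% 8 < 8)%N by rewrite ltn_mod.
have b38 : ((b + 3) %% 8 < 8)%N by rewrite ltn_mod.
rewrite (@eq_card _ _ (mem [:: Ordinal b8; Ordinal b18; Ordinal b38])) => [|k].
  by rewrite (card_uniqP _) // /= !inE -!val_eqE /=; lia.
by rewrite !inE on_tripoint // !inE -!val_eqE.
Qed.

Lemma triple_pointP p : triple_points C p -> exists2 b, (b < 8)%N & p = tripoint b.
Proof.
rewrite /triple_points /= /multiplicity => h.
have /card_gt2P [i [j [k [[pi pj pk] [ij jk ki]]]]] :
  (2 < #|[pred i | on_line p (C i)]|)%N by rewrite h.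
rewrite !inE in pi pj pk; have ik : i != k by rewrite eq_sym.
have pE := meetP ij pi pj.
move: pk; rewrite pE on_meet // colC8 // => cl.
have H : all (fun i => all (fun j => all (fun k => coll maclane.2 i j k ==>
    has (fun b => (i \in block b) && (j \in block b)) (iota 0 8))
    (iota 0 8)) (iota 0 8)) (iota 0 8).
  by vm_compute.
have := allP (allP (allP H i _) j _) k; rewrite !mem_iota !ltn_ord => /(_ isT isT isT).
rewrite cl => /hasP[b]; rewrite mem_iota => b8 /andP[ib jb]; exists b => //.
by apply/esym/meetP; rewrite ?on_tripoint.
Qed.

Lemma triple_pointsE : triple_points C = tripoint @` `I_8.
Proof.
apply/seteqP; split=> [p /triple_pointP [b b8 ->]|_ [b b8 <-]]; first by exists b.
exact: multiplicity_tripoint.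
Qed.

Lemma triple_points_lineE (i : 'I_8) : triple_points C `&` [set p | on_line p (C i)] =
  (tripoint \o block_through i) @` `I_3.
Proof.
have H : all (fun i => all (fun b => (i \in block b) ==>
    has (fun k => block_through i k == b) (iota 0 3)) (iota 0 8)) (iota 0 8) by vm_compute.
have H' : all (fun i => all (fun k => i \in block (block_through i k)) (iota 0 3)) (iota 0 8).
  by vm_compute.
apply/seteqP; split=> [p [/triple_pointP [b b8 ->]] /=|_ [k k3 <-]].
  rewrite on_tripoint // => ib.
  have := allP (allP H i _) b; rewrite !mem_iota ltn_ord => /(_ isT b8).
  rewrite ib => /hasP[k]; rewrite mem_iota => k3 /eqP e; exists k => //=.
  by rewrite e.
have b8 : (block_through i k < 8)%N by rewrite ltn_mod.
split; first exact: multiplicity_tripoint.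
rewrite /= on_tripoint //.
by have := allP (allP H' i _) k; rewrite !mem_iota ltn_ord => /(_ isT k3).
Qed.

Lemma is_maclaneP : is_maclane C.
Proof.
split=> //.
- rewrite triple_pointsE; apply: inj_card_eq => b b'; rewrite !inE /= => b8 b8'.
  exact: tripoint_inj.
- move=> i; rewrite triple_points_lineE; apply: inj_card_eq => k k'; rewrite !inE /= => k3 k3' e.
  have H : all (fun i => all (fun k => all (fun k' => (block_through i k == block_through i k')
     ==> (k == k')) (iota 0 3)) (iota 0 3)) (iota 0 8) by vm_compute.
  have := allP (allP (allP H i _) k _) k'; rewrite !mem_iota ltn_ord => /(_ isT k3 k3').
  move=> /implyP h; apply/eqP/h/eqP; apply: tripoint_inj e; exact: ltn_mod.
Qed.
End MacLane.

Lemma matches_maclane (K : numFieldType) n (A : config K n) (i0 : 'I_n) m :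
  is_arrangement A -> matches A i0 maclane m -> contains_maclane A.
Proof.
move=> Ainj H; have [sm um hm] := H.
have finj : injective (fun i : 'I_8 => nth i0 m i).
  by move=> i j /eqP; rewrite nth_uniq ?sm // => /eqP /val_inj.
exists (fun i : 'I_8 => nth i0 m i) => //; apply: is_maclaneP.
  by move=> i j; rewrite !ffunE => /Ainj /finj.
move=> i j k ij ik jk; rewrite -(matches_col H) //.
by rewrite /col !ffunE.
Qed.

(** Deleting one point leaves the cyclic pattern: 2 from [maclane9], 3 from [maclane11], 6 from
    [hesse], which is the affine plane of order three. *)
Lemma matches_contains_maclane (K : numFieldType) n (A : config K n) (i0 : 'I_n) p m :
  is_arrangement A -> p \in [:: maclane; maclane9; maclane11; hesse] ->
  matches A i0 p m -> contains_maclane A.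
Proof.
move=> Ainj; rewrite !inE => /or4P[] /eqP -> H.
- exact: matches_maclane H.
- apply: matches_maclane Ainj _.
  exact: (@matches_sub _ _ _ _ maclane maclane9 [:: 0; 3; 8; 6; 1; 5; 4; 7]%N _ isT H).
- apply: matches_maclane Ainj _.
  exact: (@matches_sub _ _ _ _ maclane maclane11 [:: 0; 1; 5; 2; 4; 8; 7; 6]%N _ isT H).
- apply: matches_maclane Ainj _.
  exact: (@matches_sub _ _ _ _ maclane hesse [:: 0; 1; 3; 2; 5; 8; 7; 4]%N _ isT H).
Qed.


(** * Falk-Sturmfels arrangements and arrangements over the Gaussian numbers *)

Section Iso.
Variables (K : numFieldType) (A B : config K 9) (i0 : 'I_9) (p : pattern) (m : seq 'I_9).
Hypothesis Ainj : is_arrangement A.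
Hypothesis p9 : p.1 = 9%N.
Hypothesis Am : matches A i0 p m.
Hypothesis Bp : forall i j k : 'I_9, i != j -> i != k -> j != k -> col B i j k = coll p.2 i j k.
Hypothesis free : all (fun i => all (fun j => (i != j) ==>
  has (fun k => [&& i != k, j != k & ~~ coll p.2 i j k]) (iota 0 9)) (iota 0 9)) (iota 0 9).

(** If two lines of [B] coincided, every triple containing both would be collinear, against
    [free]. *)
Lemma pattern_arrangement : is_arrangement B.
Proof.
move=> i j Bij; apply/eqP/idPn => ij.
have := allP (allP free i _) j; rewrite !mem_iota !ltn_ord => /(_ isT isT) /implyP/(_ ij).
case/hasP => k; rewrite mem_iota => k9 /and3P[ik jk].
rewrite -(Bp (k := Ordinal k9)) //; by rewrite /col Bij det3_uuv eqxx.
Qed.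

Lemma pattern_lattice_isomorphic : lattice_isomorphic A B.
Proof.
have [sm um hm] := Am; rewrite p9 in sm.
have mm i : i \in m.
  have := @uniq_min_size _ m (enum 'I_9) um; rewrite size_enum_ord sm => H.
  have [|_ ->] := H _ isT; first by move=> j _; rewrite mem_enum.
  by rewrite mem_enum.
have im i : (index i m < 9)%N by have := index_mem i m; rewrite sm mm.
have finj : injective (fun i => Ordinal (im i)).
  by move=> i j [] e; rewrite -(nth_index i0 (mm i)) e nth_index.
exists (perm finj); apply: dim_meet_perm => //; first exact: pattern_arrangement.
have ne i j : i != j -> index i m != index j m.
  by apply: contra_neq => e; rewrite -(nth_index i0 (mm i)) e nth_index.
move=> i j k ij ik jk; rewrite !permE Bp ?ne //=.
by rewrite -(matches_col Am) ?p9 ?ne // !nth_index.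
Qed.
End Iso.

(* Elements p + q theta of Z[theta], where theta^2 = u theta + w, as pairs (p, q). *)
Section Quadratic.
Variables (K : numFieldType) (theta : K) (u w : int).
Hypothesis thetaE : theta ^+ 2 = u%:~R * theta + w%:~R.

Definition qint := (int * int)%type.
Definition qmul (a b : qint) : qint :=
  (a.1 * b.1 + w * (a.2 * b.2), a.1 * b.2 + a.2 * b.1 + u * (a.2 * b.2)).
Definition qsub (a b : qint) : qint := (a.1 - b.1, a.2 - b.2).
Definition qadd (a b : qint) : qint := (a.1 + b.1, a.2 + b.2).
(** The product with the conjugate, in which [theta] becomes [u - theta]. A non-zero norm certifies
    a non-zero value by integer arithmetic alone. *)
Definition qnorm (a : qint) : int := a.1 ^+ 2 + u * a.1 * a.2 - w * a.2 ^+ 2.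
Definition qval (a : qint) : K := a.1%:~R + a.2%:~R * theta.

Definition qvec := (qint * qint * qint)%type.
Definition qvec0 : qvec := ((0, 0), (0, 0), (0, 0)).
Definition qrow (v : qvec) : 'rV[K]_3 := row3 (qval v.1.1) (qval v.1.2) (qval v.2).
Definition qdet (a b c : qvec) : qint :=
  qadd (qsub (qmul a.1.1 (qsub (qmul b.1.2 c.2) (qmul b.2 c.1.2)))
             (qmul a.1.2 (qsub (qmul b.1.1 c.2) (qmul b.2 c.1.1))))
       (qmul a.2 (qsub (qmul b.1.1 c.1.2) (qmul b.1.2 c.1.1))).

Lemma qvalM a b : qval (qmul a b) = qval a * qval b.
Proof.
have -> : qval a * qval b = a.1%:~R * b.1%:~R + (a.1%:~R * b.2%:~R + a.2%:~R * b.1%:~R) * theta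
   + a.2%:~R * b.2%:~R * theta ^+ 2 by rewrite /qval; ring.
by rewrite thetaE /qval /= !(rmorphD, rmorphM) /=; ring.
Qed.

Lemma qvalB a b : qval (qsub a b) = qval a - qval b.
Proof. by rewrite /qval /= !rmorphB /=; ring. Qed.

Lemma qvalD a b : qval (qadd a b) = qval a + qval b.
Proof. by rewrite /qval /= !rmorphD /=; ring. Qed.

Lemma qval_neq0 a : qnorm a != 0 -> qval a != 0.
Proof.
apply: contra_neq => h; apply/eqP; rewrite -(intr_eq0 K); apply/eqP.
have -> : (qnorm a)%:~R = qval a * (a.1%:~R + u%:~R * a.2%:~R - a.2%:~R * theta) :> K.
  rewrite /qval /qnorm !(rmorphD, rmorphB, rmorphM, rmorphXn) /=.
  have -> : (a.1%:~R + a.2%:~R * theta) * (a.1%:~R + u%:~R * a.2%:~R - a.2%:~R * theta) =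
    a.1%:~R ^+ 2 + u%:~R * a.1%:~R * a.2%:~R + u%:~R * a.2%:~R ^+ 2 * theta
      - a.2%:~R ^+ 2 * theta ^+ 2 :> K by ring.
  by rewrite thetaE; ring.
by rewrite h mul0r.
Qed.

Lemma qdetE a b c : det3 (qrow a) (qrow b) (qrow c) = qval (qdet a b c).
Proof. by rewrite /det3 !mxE /= qvalD qvalB !qvalM !qvalB !qvalM. Qed.

Definition qrealizes (p : pattern) (pts : seq qvec) : bool :=
  let v := nth qvec0 pts in
  all (fun t => all (fun b => all (fun a => let d := qdet (v a) (v b) (v t) in
     if coll p.2 a b t then d == (0, 0) else qnorm d != 0)
   (iota 0 b)) (iota 0 t)) (iota 0 9).

Lemma qrealizesP p pts (B : config K 9) : qrealizes p pts ->
  (forall i : 'I_9, val (B i) = <[qrow (nth qvec0 pts i)]>%VS) ->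
  forall i j k : 'I_9, i != j -> i != k -> j != k -> col B i j k = coll p.2 i j k.
Proof.
move=> /allP H hB i j k; rewrite (col_vline hB) -!val_eqE.
have : (i < 9)%N /\ (j < 9)%N /\ (k < 9)%N by rewrite !ltn_ord.
case=> + []; rewrite /=; move: (val i) (val j) (val k).
apply: sort3 => [a b t h|a b t h|a t|a b t abt].
- by move=> a9 b9 t9 ab a_t bt; rewrite det3_swap12 oppr_eq0 coll_C h // eq_sym.
- by move=> a9 b9 t9 ab a_t bt; rewrite det3_swap23 oppr_eq0 coll_CA h // eq_sym.
- by rewrite eqxx.
have /andP[ab bt] := abt.
have iotaP x y : (x < y)%N -> x \in iota 0 y by rewrite mem_iota.
move=> _ _ t9 _ _ _.
have /allP/(_ _ (iotaP _ _ bt))/allP/(_ _ (iotaP _ _ ab)) := H _ (iotaP _ _ t9).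
rewrite qdetE; lazy zeta; case: ifP => _; last by move/qval_neq0/negPf.
by move/eqP ->; rewrite /qval /= mul0r addr0 eqxx.
Qed.

Definition qnonzero (v : qvec) : bool :=
  [|| qnorm v.1.1 != 0, qnorm v.1.2 != 0 | qnorm v.2 != 0].

Lemma val_hpoint_qrow a b c v : qnonzero v ->
  qval v.1.1 = a -> qval v.1.2 = b -> qval v.2 = c -> val (hpoint a b c) = <[qrow v]>%VS.
Proof.
move=> nz <- <- <-; rewrite val_hpoint //.
apply/eqP => /rowP h; move: (h o0) (h o1) (h o2); rewrite !mxE /= => h0 h1 h2.
by move: nz; case/or3P => /qval_neq0; rewrite ?h0 ?h1 ?h2 eqxx.
Qed.
End Quadratic.

Definition falk_sturmfels_pattern : pattern :=
  (9, [:: [:: 0; 1; 2; 3]; [:: 0; 4; 8]; [:: 0; 5; 6]; [:: 1; 4; 7]; [:: 1; 5; 8];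
          [:: 2; 5; 7]; [:: 2; 6; 8]; [:: 3; 4; 6]; [:: 3; 7; 8]])%N.

Definition falk_sturmfels_points : seq qvec :=
  [:: ((1, 0), (0, 0), (0, 0)); ((1, 0), (0, -1), (0, 1)); ((0, 0), (1, 0), (-1, 0));
      ((1, 0), (1, 0), (-1, 0)); ((1, 0), (0, 0), (-1, 0)); ((1, 0), (0, -1), (0, 0));
      ((0, 0), (1, 0), (0, 0)); ((1, 0), (1, 0), (-1, -1)); ((0, 0), (0, 0), (1, 0))].

Definition sqrtN1_points : seq qvec :=
  [:: ((1, 0), (0, 0), (0, 0)); ((0, 0), (1, 0), (0, 0)); ((1, 0), (0, 0), (-1, 0));
      ((0, 0), (1, 0), (-1, 0)); ((1, 0), (0, 0), (0, -1)); ((0, 0), (1, 0), (0, -1));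
      ((1, 0), (-1, 0), (0, 0)); ((-1, 1), (0, 1), (1, 0)); ((1, -1), (1, 0), (-1, 0))].

Section Examples.
Variable K : numClosedFieldType.

(** The incidences follow from the equation [g ^+ 2 = g + 1], which both signs satisfy. This is why
    the two arrangements share a lattice and one sign is enough. *)
Lemma falk_sturmfels_col (i j k : 'I_9) : i != j -> i != k -> j != k ->
  col (falk_sturmfels K false) i j k = coll falk_sturmfels_pattern.2 i j k.
Proof.
pose g : K := (1 + (-1) ^+ false * sqrtC 5) / 2.
have gE : g ^+ 2 = 1%:~R * g + 1%:~R.
  rewrite /g expr0 mul1r.
  have -> : ((1 + sqrtC 5) / 2) ^+ 2 = (1 + 2 * sqrtC 5 + sqrtC 5 ^+ 2) / 4 :> K by field.
  by rewrite sqrtCK; field.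
apply: (@qrealizesP _ g 1 1 gE _ falk_sturmfels_points); first by vm_compute.
move=> l; rewrite ffunE (tnth_nth (hpoint 0 0 0)) -/g.
by case: l => [[|[|[|[|[|[|[|[|[|//]]]]]]]]] l9] /=;
  apply: (val_hpoint_qrow gE); rewrite // /qval /=; ring.
Qed.

Lemma sqrtN1_col (i j k : 'I_9) : i != j -> i != k -> j != k ->
  col (arrangement_sqrtN1 K false) i j k = coll gaussian.2 i j k.
Proof.
pose g : K := (-1) ^+ false * 'i.
have gE : g ^+ 2 = 0%:~R * g + (-1)%:~R by rewrite /g expr0 mul1r sqrCi mul0r add0r.
apply: (@qrealizesP _ g 0 (-1) gE _ sqrtN1_points); first by vm_compute.
move=> l; rewrite ffunE (tnth_nth (hpoint 0 0 0)) -/g.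
by case: l => [[|[|[|[|[|[|[|[|[|//]]]]]]]]] l9] /=;
  apply: (val_hpoint_qrow gE); rewrite // /qval /=; ring.
Qed.

Lemma matches_golden (A : config K 9) (i0 : 'I_9) m : is_arrangement A ->
  matches A i0 golden m -> lattice_isomorphic A (falk_sturmfels K false).
Proof.
move=> Ainj H.
(* Line [i] of [falk_sturmfels_pattern] is point [nth 0 idx i] of [golden]: the quadruple 0 1 2 3
   becomes 1 3 5 7. *)
pose idx := [:: 1; 3; 5; 7; 2; 6; 8; 4; 0]%N.
have H' := @matches_sub _ _ _ _ falk_sturmfels_pattern golden idx _ isT H.
apply: (pattern_lattice_isomorphic Ainj _ H') => //; first exact: falk_sturmfels_col.
Qed.

Lemma matches_gaussian (A : config K 9) (i0 : 'I_9) m : is_arrangement A ->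
  matches A i0 gaussian m -> lattice_isomorphic A (arrangement_sqrtN1 K false).
Proof.
move=> Ainj H.
apply: (pattern_lattice_isomorphic Ainj _ H) => //; exact: sqrtN1_col.
Qed.
End Examples.

Theorem theorem3p9 (R : realType) (A : config R[i]%C 9) (hA : is_arrangement A) :
  irreducible_space (moduli_space A) \/
  contains_maclane A \/
  (exists s : bool, lattice_isomorphic A (falk_sturmfels R[i]%C s)) \/
  (exists s : bool, lattice_isomorphic A (arrangement_sqrtN1 R[i]%C s)).
Proof.
have [J|[S /finset.set0Pn [i0 i0S] hS]] := joined_or_rich hA finset.setT.
  by left; exact: joined_irreducible.
have S9 : (size (enum S) <= 9)%N by rewrite -cardE (leq_trans (max_card _)) ?card_ord.
have rS x : x \in enum S -> rich (fun y => y \in enum S) (col A) x.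
  rewrite mem_enum => /hS [a1 [b1 [a2 [b2 [a3 [b3 [h1 h2 h3 h4]]]]]]].
  exists a1, b1, a2, b2, a3, b3; split=> //; apply: sub_all h1 => y.
  by rewrite mem_enum.
have i0e : i0 \in enum S by rewrite mem_enum.
have [p pp [m Hm]] := rich_pattern (enum_uniq _) S9 (@colC _ _ A) (@colCA _ _ A)
  (@col_iij _ _ A) (col_trans hA) rS i0e.
have {}Hm : matches A i0 p m by [].
move: pp; rewrite !inE.
do ![case/orP => [/eqP pE|]]; last move=> /eqP pE; rewrite pE in Hm.
- by case: (not_matches_fano hA Hm).
- by right; left; apply: matches_contains_maclane Hm; rewrite ?inE.
- by right; left; apply: matches_contains_maclane Hm; rewrite ?inE ?eqxx ?orbT.
- by right; left; apply: matches_contains_maclane Hm; rewrite ?inE ?eqxx ?orbT.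
- by right; left; apply: matches_contains_maclane Hm; rewrite ?inE ?eqxx ?orbT.
- by right; right; left; exists false; exact: matches_golden Hm.
- by right; right; right; exists false; exact: matches_gaussian Hm.
- by left; apply/joined_irreducible/(matches_joined hA _ Hm); rewrite // !inE eqxx ?orbT.
- by left; apply/joined_irreducible/(matches_joined hA _ Hm); rewrite // !inE eqxx ?orbT.
- by left; apply/joined_irreducible/(matches_joined hA _ Hm); rewrite // !inE eqxx ?orbT.
- by case: (not_matches_ten_char2 hA Hm).
- by left; apply/joined_irreducible/(matches_joined hA _ Hm); rewrite // !inE eqxx ?orbT.
Qed.
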